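(* Let $(X,\mu)$ be a differentiability space, with canonical norm $\|\cdot\|$ on $TX$, and let $\gamma:C\to X$ be a curve fragment (a Lipschitz map with $C\subset\mathbb R$ closed). Genericity is understood with respect to the data $(\mathcal F,\mathcal C,D_X,Y)$ fixed in the context. (1) If $(\gamma,t)$ is a generic pair, then $t$ is a point of metric differentiability of $\gamma$: there is a constant $c\ge0$ (denoted $\|\tfrac{\partial}{\partial t}\|_\gamma(t)$) such that for every $R>0$, $$\lim_{\lambda\to\infty}\ \sup\Big\{\big|\lambda\, d_X(\gamma(t+\lambda^{-1}s_1),\gamma(t+\lambda^{-1}s_2))-c\,|s_1-s_2|\big| : s_1,s_2\in[-R,R],\ t+\lambda^{-1}s_1,\,t+\lambda^{-1}s_2\in C\Big\}=0,$$ and moreover $\|\gamma'(t)\|=\|\tfrac{\partial}{\partial t}\|_\gamma(t)$. (2) If $\gamma$ is generic, i.e. $(\gamma,t)$ is a generic pair for $\mathcal L^1$-a.e. $t\in C$, then $$\operatorname{length}(\gamma)=\int_C\|\gamma'(t)\|\,d\mathcal L^1(t).$$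
   Context: Differentiability spaces. $X$ is a complete separable metric space with metric $d_X$, and $\mu$ is a Radon measure on $X$. For a Lipschitz $f:X\to\mathbb R$, $\operatorname{Lip}f(x)=\limsup_{r\searrow0}\sup\{|f(y)-f(x)|/r:d_X(x,y)\le r\}$. Finitely many Lipschitz functions are dependent at $x$ if some nontrivial linear combination $v$ of them satisfies $\operatorname{Lip}v(x)=0$; otherwise they are independent at $x$. An $n$-dimensional chart ($n\ge1$) is a pair $(U,\phi)$ with $U\subset X$ Borel, $\mu(U)>0$, $\phi=(\phi^1,\dots,\phi^n):X\to\mathbb R^n$ Lipschitz, such that $\phi^1,\dots,\phi^n$ are independent at $\mu$-a.e. $x\in U$, and for every Lipschitz $f:X\to\mathbb R$ the tuple $(\phi^1,\dots,\phi^n,f)$ is dependent at $\mu$-a.e. $x\in U$; thus there are $\mu$-a.e. unique Borel functions $\partial f/\partial\phi^i$ on $U$ with $f(x)=f(x_0)+\sum_i\frac{\partial f}{\partial\phi^i}(x_0)(\phi^i(x)-\phi^i(x_0))+o(d_X(x,x_0))$ for $\mu$-a.e. $x_0\in U$ ($f$ is differentiable at $x_0$ with respect to $\phi$). $(X,\mu)$ is a differentiability space if there is a countable collection (atlas) of charts $\{(U_\alpha,\phi_\alpha)\}$ with $\mu(X\setminus\bigcup_\alpha U_\alpha)=0$; an atlas is fixed such that at each point of $U_\alpha\cap U_\beta$ the components of $\phi_\alpha$ are differentiable with respect to $\phi_\beta$. The cotangent bundle $T^*X$ is the measurable vector bundle whose fibre over $x\in U_\alpha$ has basis $d\phi_\alpha^i(x)$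 (transition maps given by the partial derivatives of the charts), $df(x)=\sum_i\frac{\partial f}{\partial\phi_\alpha^i}(x)\,d\phi_\alpha^i(x)$, and $TX$ is the dual bundle. The norm on $T^*X$ is $\|\sum_ia_i\,d\phi^i_\alpha(x)\|_{\mathrm{Lip}}=\operatorname{Lip}(\sum_ia_i\phi_\alpha^i)(x)$ (a norm for a.e. $x$). The canonical norm $\|\cdot\|$ on $TX$ is its dual norm; for any countable dense set $D_X\subset X$ it satisfies, for $\mu$-a.e. $p$, $\|v\|=\sup_{x\in D_X}|d(d_X(\cdot,x))(v)|$ for all $v\in T_pX$. Genericity. Fix: a countable dense set $D_X\subset X$; a countable collection $\mathcal F$ of real Lipschitz functions on $X$ containing all components of all $\phi_\alpha$; a Borel set $Y\subset\bigcup_\alpha U_\alpha$ with $\mu(X\setminus Y)=0$ at every point $p$ of which all the functions $d_X(\cdot,x)$, $x\in D_X$, are differentiable with respect to the chart functions and $\|v\|=\sup_{x\in D_X}|d(d_X(\cdot,x))(v)|$ for all $v\in T_pX$; and a countable collection $\mathcal C$ of bounded real Borel functions on $X$ containing all $\chi_{U_\alpha}$ and $\chi_Y$. A pair $(\gamma,t)$ with $\gamma:C\to X$ a fragment and $t\in C$ is generic if: $t$ is a Lebesgue density point of $C$; for each $f\in\mathcal F$ the derivative $(f\circ\gamma)'$ exists and is approximately continuous at $t$; for each $u\in\mathcal C$, $u\circ\gamma$ is approximately continuous at $t$; for each $x\in D_X$ the derivative $(d_X(\cdot,x)\circ\gamma)'$ exists and is approximately continuous at $t$; the function $\sup_{x\in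 D_X}|(d_X(\cdot,x)\circ\gamma)'|$ is approximately continuous at $t$; and $\gamma(t)\in Y$. For a generic pair with $\gamma(t)\in U_\alpha$, the velocity $\gamma'(t)\in T_{\gamma(t)}X$ is the vector with $d\phi_\alpha^i(\gamma'(t))=(\phi_\alpha^i\circ\gamma)'(t)$. The length of a fragment is taken to be $\operatorname{length}(\gamma)=\int_X\#\{t\in C:\gamma(t)=x\}\,d\mathscr H^1(x)$, where $\mathscr H^1$ is $1$-dimensional Hausdorff measure. *)

(* Defs.v *)
From HB Require Import structures.
From mathcomp Require Import all_boot all_order all_algebra.
From mathcomp Require Import all_classical all_reals all_analysis.

Set Implicit Arguments.
Unset Strict Implicit.
Unset Printing Implicit Defensive.
Import Order.TTheory GRing.Theory Num.Theory.
Import numFieldNormedType.Exports.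

Local Open Scope classical_set_scope.
Local Open Scope ring_scope.

(* Complete metric spaces; a base point is part of the structure because
   measurable types are pointed in the library. *)
#[short(type="completeMetricType")]
HB.structure Definition CompleteMetric (R : numDomainType) :=
  {T of Pointed T & Complete T & Metric R T}.

Definition borel (R : realType) (X : completeMetricType R) :=
  g_sigma_algebraType (@open X).

Section MetricSpace.
Context {R : realType}.

Definition metric_lipschitz (X Y : metricType R) (A : set X) (f : X -> Y) :=
  exists k : R, forall x y, A x -> A y -> mdist (f x) (f y) <= k * mdist x y.

Definition real_lipschitz (X : metricType R) (f : X -> R) :=
  @metric_lipschitz X R^o setT f.

Definition dist_from (X : metricType R) (x : X) : X -> R := fun y => mdist y x.

(* Countable covers are indexed by nat; finite covers are padded with the empty
   set, whose diameter is 0. *)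
Definition diam (X : metricType R) (E : set X) : \bar R :=
  maxe 0%E (ereal_sup [set (mdist p.1 p.2)%:E | p in E `*` E]).

Definition hausdorff1_delta (X : metricType R) (delta : R) (E : set X) :
    \bar R :=
  ereal_inf [set (\sum_(0 <= i <oo) diam (G i))%E | G in
    [set G : (set X)^nat | E `<=` \bigcup_i G i /\
       forall i, (diam (G i) <= delta%:E)%E]].

Definition hausdorff1 (X : metricType R) (E : set X) : \bar R :=
  ereal_sup [set hausdorff1_delta delta E | delta in [set d : R | 0 < d]].

Definition radon (X : completeMetricType R)
    (mu : {measure set (borel X) -> \bar R}) :=
  (forall x : X, exists2 e : R, 0 < e & (mu (ball x e) < +oo)%E) /\
  (forall A : set (borel X), measurable A ->
     mu A = ereal_sup [set mu K | K in [set K : set X | compact K /\ K `<=` A]]).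

End MetricSpace.

Section Differentiability.
Context {R : realType} {X : completeMetricType R}.

Definition Lip (f : X -> R) (x : X) : \bar R :=
  limf_esup (fun r : R =>
    ereal_sup [set (`|f y - f x| / r)%:E | y in [set y | mdist x y <= r]])
    (0 : R)^'+.

Definition dependent (I : finType) (g : I -> X -> R) (x : X) :=
  exists c : I -> R, (exists i, c i != 0) /\
    Lip (fun y => \sum_i c i * g i y) x = 0%E.

Definition independent (I : finType) (g : I -> X -> R) (x : X) :=
  ~ dependent g x.

(* The extended tuple (phi, f) is indexed by option 'I_n. *)
Definition is_chart (mu : {measure set (borel X) -> \bar R})
    (n : nat) (U : set (borel X)) (phi : 'I_n -> X -> R) :=
  [/\ (0 < n)%N,
      measurable U /\ (0 < mu U)%E,
      forall i, real_lipschitz (phi i),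
      {ae mu, forall x, U x -> independent phi x}
    & forall f : X -> R, real_lipschitz f ->
        {ae mu, forall x, U x -> dependent (fun o => oapp phi f o) x}].

Definition is_differential (n : nat) (phi : 'I_n -> X -> R) (f : X -> R)
    (p : X) (c : 'rV[R]_n) :=
  (fun x => f x - f p - \sum_i c 0 i * (phi i x - phi i p))
    =o_p (dist_from p).

(* The partial derivatives are determined by f only if they are unique, so
   uniqueness is part of differentiability, as it is in the literature. *)
Definition differentiable_wrt (n : nat) (phi : 'I_n -> X -> R) (f : X -> R)
    (p : X) :=
  exists! c, is_differential phi f p c.

Definition partials (n : nat) (phi : 'I_n -> X -> R) (f : X -> R) (p : X) :
    'rV[R]_n :=
  xget 0 [set c | is_differential phi f p c].

Record chart_family := ChartFamily {
  chart : countType;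
  chart_dim : chart -> nat;
  chart_dom : chart -> set (borel X);
  chart_fun : forall a, 'I_(chart_dim a) -> X -> R }.
Arguments chart_fun {c} a i.

Definition is_atlas (mu : {measure set (borel X) -> \bar R})
    (A : chart_family) :=
  [/\ forall a : chart A, is_chart mu (chart_dom a) (chart_fun a),
      mu (~` \bigcup_(a : chart A) chart_dom a) = 0%E
    & forall (a b : chart A) p, chart_dom a p -> chart_dom b p ->
        forall i, differentiable_wrt (chart_fun b) (chart_fun a i) p].

Section Bundle.
Variable A : chart_family.

(* A covector at p is given by a chart a around p and its coordinates in the
   basis (d phi_a^i(p)); a tangent vector, by the tuple of its values on this
   basis for every chart a around p (the entries of the family at the charts
   that do not contain p are irrelevant). *)
Definition lip_norm (a : chart A) (p : X) (c : 'rV[R]_(chart_dim a)) : \bar R :=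
  Lip (fun y => \sum_i c 0 i * chart_fun a i y) p.

Definition pairing n (c v : 'rV[R]_n) : R := \sum_i c 0 i * v 0 i.

Definition tangent (p : X) (v : forall a : chart A, 'rV[R]_(chart_dim a)) :=
  forall a b, chart_dom a p -> chart_dom b p -> forall i : 'I_(chart_dim a),
    v a 0 i = pairing (partials (chart_fun b) (chart_fun a i) p) (v b).

Definition tangent_norm (p : X) (v : forall a : chart A, 'rV[R]_(chart_dim a)) :
    \bar R :=
  ereal_sup [set e | exists (a : chart A) (c : 'rV[R]_(chart_dim a)),
    [/\ chart_dom a p, (lip_norm p c <= 1)%E & e = `|pairing c (v a)|%:E]].

Definition norm_from_distances (D : set X) (p : X) :=
  forall a : chart A, chart_dom a p ->
    (forall x, D x -> differentiable_wrt (chart_fun a) (dist_from x) p) /\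
    (forall v, tangent p v ->
       tangent_norm p v =
       ereal_sup [set `|pairing (partials (chart_fun a) (dist_from x) p)
                                (v a)|%:E | x in D]).

End Bundle.

End Differentiability.

Arguments chart_family {R} X.
Arguments chart_fun {R X c} a i.

Section Fragments.
Context {R : realType}.
Implicit Types (C E : set R) (u : R -> R) (t : R).

Definition density_point E t :=
  (lebesgue_measure (E `&` ball t r) * (lebesgue_measure (ball t r))^-1
     @[r --> 0^'+] --> 1)%E.

(* E is the domain of definition of u. *)
Definition approx_continuous E u t :=
  E t /\ forall e, 0 < e ->
    density_point [set s | E s /\ `|u s - u t| < e] t.

Definition frag_quotients C u t :=
  (u s - u t) / (s - t) @[s --> within C t^'].

Definition frag_derivable C u : set R :=
  [set t | [/\ C t, limit_point C t & cvg (frag_quotients C u t)]].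

Definition frag_derive C u t : R := lim (frag_quotients C u t).

Context {X : completeMetricType R}.

(* A fragment is represented by a closed set C and a map on the whole line of
   which only the restriction to C matters. *)
Definition is_fragment C (gamma : R -> X) :=
  closed C /\ @metric_lipschitz R R^o X C gamma.

Definition dist_speed C (gamma : R -> X) (D : set X) t : R :=
  sup [set `|frag_derive C (dist_from x \o gamma) t| | x in D].

Definition generic (F Bf : set (X -> R)) (D Y : set X) C (gamma : R -> X) t :=
  [/\ C t /\ density_point C t,
      forall f, F f ->
        approx_continuous (frag_derivable C (f \o gamma))
          (frag_derive C (f \o gamma)) t,
      forall u : X -> R, Bf u -> approx_continuous C (u \o gamma) t,
      (forall x, D x ->
        approx_continuous (frag_derivable C (dist_from x \o gamma))
          (frag_derive C (dist_from x \o gamma)) t) /\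
      approx_continuous
        (C `&` \bigcap_(x in D) frag_derivable C (dist_from x \o gamma))
        (dist_speed C gamma D) t
    & Y (gamma t)].

Definition velocity (A : chart_family X) C (gamma : R -> X) t
    (a : chart A) : 'rV[R]_(chart_dim a) :=
  \row_i frag_derive C (chart_fun a i \o gamma) t.

Definition has_metric_derivative C (gamma : R -> X) t (c : R) :=
  forall r : R, 0 < r ->
    ereal_sup
      [set `|l * mdist (gamma (t + l^-1 * s.1)) (gamma (t + l^-1 * s.2))
             - c * `|s.1 - s.2| |%:E
       | s in [set s : R * R |
           [/\ - r <= s.1 <= r, - r <= s.2 <= r,
               C (t + l^-1 * s.1) & C (t + l^-1 * s.2)]]]
    @[l --> +oo%R] --> 0%E.

(* The integral is taken over the Borel sigma-algebra, so hausdorff1 is only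
   evaluated on Borel sets, on which it is a measure. *)
Definition frag_length C (gamma : R -> X) : \bar R :=
  (\int[@hausdorff1 R X : set (borel X) -> \bar R]_(x in [set: borel X])
     counting (C `&` gamma @^-1` [set x]))%E.

End Fragments.

(* Main.v *)
(* For a closed set C and a generic pair (gamma, t), the speed at t is
   c = sup_x |(d(., x) o gamma)'(t)|, x ranging over the dense set; the chain
   rule through the charts identifies it with the norm of the velocity.  A single
   x almost realizing the supremum bounds d(gamma s1, gamma s2) from below.  From
   above, d(gamma s1, gamma s2) is the supremum over x of the increments of
   d(., x) o gamma; by approximate continuity of the speed these functions have,
   outside a set of small density which does not depend on x, slope at most
   c + e, and a K-Lipschitz function whose slope is at most c + e on E maps
   [s1, s2] onto a set of length at most (c + e) |E| + K |[s1, s2] \ E|.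

   The length formula is the area formula for fragments with metric derivative m
   almost everywhere.  Upper bound: H^1(gamma(E)) <= int_E m by slicing E along
   the levels of m, and the multiplicity is dominated by the liminf of the number
   of cells of finer and finer grids whose image contains the point (Fatou).
   Lower bound: almost all of {m > 0} is a disjoint union of Borel sets on which
   gamma expands distances by a factor close to m; exhaust them by compact sets,
   whose images are Borel. *)
Require Import Defs.
From HB Require Import structures.
From mathcomp Require Import all_boot all_order all_algebra finmap.
From mathcomp Require Import all_classical all_reals all_analysis.
From mathcomp Require Import measurable_realfun ring lra zify.

Set Implicit Arguments.
Unset Strict Implicit.
Unset Printing Implicit Defensive.
Import Order.TTheory GRing.Theory Num.Theory.
Import numFieldNormedType.Exports.

Local Open Scope classical_set_scope.
Local Open Scope ring_scope.

(** * The Hausdorff outer measure *)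

Section Diameter.
Context {R : realType} {X : metricType R}.
Local Open Scope ereal_scope.
Implicit Types (E A B : set X).

Lemma diam_ge0 E : 0 <= diam E.
Proof. by rewrite /diam le_max lexx. Qed.

Lemma mdist_le_diam E x y : E x -> E y -> (mdist x y)%:E <= diam E.
Proof.
move=> Ex Ey; rewrite /diam le_max; apply/orP; right.
by apply: ereal_sup_ubound; exists (x, y).
Qed.

Lemma diam_le E b : 0 <= b ->
  (forall x y, E x -> E y -> (mdist x y)%:E <= b) -> diam E <= b.
Proof.
move=> b0 Eb; rewrite /diam ge_max b0/=; apply: ge_ereal_sup => _ [[x y] [/= Ex Ey] <-].
exact: Eb.
Qed.

Lemma diam_set0 : diam (@set0 X) = 0.
Proof. by apply/eqP; rewrite eq_le diam_ge0 andbT; apply: diam_le. Qed.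

Lemma le_diam A B : A `<=` B -> diam A <= diam B.
Proof.
move=> AB; apply: diam_le => [|x y Ax Ay]; first exact: diam_ge0.
by apply: mdist_le_diam; exact: AB.
Qed.

End Diameter.

Section HausdorffOuterMeasure.
Context {R : realType} {X : completeMetricType R}.
Local Open Scope ereal_scope.
Implicit Types (E A B : set X).

(** With every set measurable, [mu_ext] takes its infimum over arbitrary covers, as the Hausdorff
    premeasure does. *)
Local Notation discrete := (g_sigma_algebraType [set: set X]).

Let gauge (d : R) (E : set discrete) : \bar R :=
  if diam (E : set X) <= d%:E then diam (E : set X) else +oo.

Let gauge_ge0 d E : 0 <= gauge d E.
Proof. by rewrite /gauge; case: ifP => // _; rewrite ?leey//; exact: diam_ge0. Qed.

(* Truncating the diameter to +oo above d presents the premeasure as the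
   extension of a set function defined on all sets. *)
Let hausdorff1_deltaE d E : hausdorff1_delta d E = mu_ext (gauge d) E.
Proof.
apply/eqP; rewrite eq_le; apply/andP; split; apply: le_ereal_inf_tmp.
- move=> _ [G [_ EG] <-].
  have [Gd|] := pselect (forall i, diam (G i : set X) <= d%:E).
    apply: ereal_inf_lbound; exists G => //.
    by apply: eq_eseriesr => i _; rewrite /gauge Gd.
  move=> /existsNP[i /negP Gi].
  rewrite (@eseries_pinfty _ _ _ i) ?leey//.
    by move=> n _; rewrite -ltNye (lt_le_trans _ (gauge_ge0 _ _)).
  by rewrite /gauge (negbTE Gi).
- move=> _ [G [EG Gd] <-]; apply: ereal_inf_lbound; exists G.
    by split => // i; exact: sub_sigma_algebra.
  by apply: eq_eseriesr => i _; rewrite /gauge Gd.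
Qed.

Lemma hausdorff1_delta_ge0 d E : 0 <= hausdorff1_delta d E.
Proof. by rewrite hausdorff1_deltaE; apply: mu_ext_ge0. Qed.

Lemma hausdorff1_delta_sub d : sigma_subadditive (@hausdorff1_delta R X d).
Proof.
have -> : @hausdorff1_delta R X d = mu_ext (gauge d).
  by apply/funext => E; exact: hausdorff1_deltaE.
exact: (@mu_ext_sigma_subadditive _ _ R (gauge d) (gauge_ge0 d)).
Qed.

Lemma hausdorff1_delta_le d A B :
  A `<=` B -> hausdorff1_delta d A <= hausdorff1_delta d B.
Proof. by move=> AB; rewrite !hausdorff1_deltaE; apply: le_mu_ext. Qed.

Lemma hausdorff1_delta_diam d E :
  (0 < d)%R -> diam E <= d%:E -> hausdorff1_delta d E <= diam E.
Proof.
move=> d0 Ed; apply: ereal_inf_lbound.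
exists (fun i => if i is 0%N then E else set0).
  split; first by move=> x Ex; exists 0%N.
  by case=> //= _; rewrite diam_set0 lee_fin ltW.
rewrite nneseries_recl//; last by case=> [|i] _ /=; rewrite ?diam_set0 ?diam_ge0.
by rewrite /= eseries0 ?adde0// => -[|i] //= _ _; rewrite diam_set0.
Qed.

Lemma hausdorff1_delta_antitone d1 d2 E :
  (d1 <= d2)%R -> hausdorff1_delta d2 E <= hausdorff1_delta d1 E.
Proof.
move=> d12; apply: ereal_inf_le_tmp => _ [G [EG Gd] <-]; exists G => //.
by split => // i; rewrite (le_trans (Gd i))// lee_fin.
Qed.

Lemma hausdorff1_delta_le_hausdorff1 d E :
  (0 < d)%R -> hausdorff1_delta d E <= hausdorff1 E.
Proof. by move=> d0; apply: ereal_sup_ubound; exists d. Qed.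

Lemma hausdorff1_le_ub E b :
  (forall d, (0 < d)%R -> hausdorff1_delta d E <= b) -> hausdorff1 E <= b.
Proof. by move=> Eb; apply: ge_ereal_sup => _ [d /= d0 <-]; exact: Eb.
Qed.

Let hausdorff1_0 : @hausdorff1 R X set0 = 0.
Proof.
apply/eqP; rewrite eq_le; apply/andP; split.
  apply: hausdorff1_le_ub => d d0; rewrite -(@diam_set0 R X).
  by apply: hausdorff1_delta_diam; rewrite // diam_set0 lee_fin ltW.
exact: (le_trans (hausdorff1_delta_ge0 1 set0)
  (hausdorff1_delta_le_hausdorff1 _ ltr01)).
Qed.

Let hausdorff1_ge0 E : 0 <= hausdorff1 E.
Proof.
exact: (le_trans (hausdorff1_delta_ge0 1 E)
  (hausdorff1_delta_le_hausdorff1 _ ltr01)).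
Qed.

Let le_hausdorff1 : {homo @hausdorff1 R X : A B / A `<=` B >-> A <= B}.
Proof.
move=> A B AB; apply: hausdorff1_le_ub => d d0.
exact: (le_trans (hausdorff1_delta_le d AB)
  (hausdorff1_delta_le_hausdorff1 _ d0)).
Qed.

Let hausdorff1_sub : sigma_subadditive (@hausdorff1 R X).
Proof.
move=> F; apply: hausdorff1_le_ub => d d0.
rewrite (le_trans (hausdorff1_delta_sub _ _))//.
by apply: lee_nneseries => i _; rewrite ?hausdorff1_delta_ge0//;
  exact: hausdorff1_delta_le_hausdorff1.
Qed.

HB.instance Definition _ := isOuterMeasure.Build R X (@hausdorff1 R X)
  hausdorff1_0 hausdorff1_ge0 le_hausdorff1 hausdorff1_sub.

End HausdorffOuterMeasure.

(** * Borel sets are measurable for the Hausdorff outer measure *)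

Section HausdorffMeasure.
Context {R : realType} {X : completeMetricType R}.
Local Open Scope ereal_scope.
Implicit Types (E F A B : set X).
Local Notation H := (@hausdorff1 R X).

(** A set of diameter at most [d < e] cannot meet both [A] and [B], so every admissible cover of the
    union splits into covers of [A] and of [B] without increasing the sum of the diameters. *)
Lemma hausdorff1_delta_separated d e A B : (d < e)%R ->
  (forall x y, A x -> B y -> (e <= mdist x y)%R) ->
  hausdorff1_delta d A + hausdorff1_delta d B <= hausdorff1_delta d (A `|` B).
Proof.
move=> de sep; apply: le_ereal_inf_tmp => _ [G [ABG Gd] <-].
have cover E : E `<=` A `|` B ->
    hausdorff1_delta d E <= \sum_(0 <= i <oo) diam (G i `&` E).
  move=> EAB; apply: ereal_inf_lbound; exists (fun i => G i `&` E) => //; split.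
    by move=> x Ex; have [i _ Gx] := ABG _ (EAB _ Ex); exists i.
  by move=> i; rewrite (le_trans _ (Gd i))//; apply: le_diam; exact: subIsetl.
apply: (le_trans (leeD (cover _ (@subsetUl _ A B)) (cover _ (@subsetUr _ A B)))).
rewrite -nneseriesD => [|i _ _|i _ _]; last 2 first.
- exact: diam_ge0.
- exact: diam_ge0.
apply: lee_nneseries => i _; first by rewrite adde_ge0// diam_ge0.
have [[x [Gx Ax]]|GA] := pselect (G i `&` A !=set0).
  rewrite (_ : G i `&` B = set0); last first.
    rewrite -subset0 => y [Gy By].
    have := le_trans (mdist_le_diam Gx Gy) (Gd i).
    by rewrite lee_fin leNgt (lt_le_trans de)// sep.
  by rewrite diam_set0 adde0 le_diam//; exact: subIsetl.
rewrite (_ : G i `&` A = set0); last by apply/eqP/negPn/negP => /set0P.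
by rewrite diam_set0 add0e le_diam//; exact: subIsetl.
Qed.

Lemma hausdorff1_separated e A B : (0 < e)%R ->
  (forall x y, A x -> B y -> (e <= mdist x y)%R) ->
  H A + H B <= H (A `|` B).
Proof.
move=> e0 sep.
have [Hoo|] := eqVneq (H (A `|` B)) +oo; first by rewrite Hoo leey.
rewrite -ltey => Hoo.
have fin (x : \bar R) : 0 <= x -> x <= H (A `|` B) -> x \is a fin_num.
  by move=> x0 xH; rewrite ge0_fin_numE// (le_lt_trans xH).
have finB : H B \is a fin_num.
  by apply: fin; [exact: outer_measure_ge0|apply: le_outer_measure => x; right].
rewrite -leeBrDr//; apply: hausdorff1_le_ub => d1 d10.
have finA : hausdorff1_delta d1 A \is a fin_num.
  apply: fin; first exact: hausdorff1_delta_ge0.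
  rewrite (le_trans (hausdorff1_delta_le_hausdorff1 _ d10))//.
  by apply: le_outer_measure => x; left.
rewrite leeBrDr// -leeBrDl//; apply: hausdorff1_le_ub => d2 d20.
rewrite leeBrDl//.
(* A scale finer than both [d1] and [d2] dominates both terms, and being below [e] it separates [A]
   from [B]. *)
pose d := Num.min (Num.min d1 d2) (e / 2)%R.
have d0 : (0 < d)%R by rewrite !lt_min d10 d20 divr_gt0.
rewrite (le_trans _ (hausdorff1_delta_le_hausdorff1 _ d0))//.
rewrite (le_trans _ (hausdorff1_delta_separated _ sep))//.
  by apply: leeD; apply: hausdorff1_delta_antitone; rewrite !ge_min lexx ?orbT.
by rewrite gt_min ltr_pdivrMr// ltr_pMr// ltr1n orbT.
Qed.

(* Rings of the same parity around F are at positive distance from each other,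
   so the measures of the rings are summable and their tails vanish. *)
Lemma hausdorff1_caratheodory F : closed F -> H.-caratheodory F.
Proof.
move=> cF; apply: le_caratheodory_measurable => A /=.
have [Hoo|] := eqVneq (H A) +oo; first by rewrite Hoo leey.
rewrite -ltey => HA.
pose far n := [set x | A x /\ forall y, F y -> (n.+1%:R^-1 <= mdist x y)%R].
pose ring n := far n.+1 `\` far n.
have farA n : far n `<=` A by move=> x [].
have far_sep n : H (A `&` F) + H (far n) <= H A.
  rewrite addeC (le_trans (@hausdorff1_separated n.+1%:R^-1%R _ _ _ _))//.
  - by move=> x y [_ xF] [_ /xF].
  - by apply: le_outer_measure => x [/farA|[]].
(* Points of [ring i] are at distance at least 1/(i+2) from [F], while a point of [ring j] has a
   point of [F] within 1/(j+1). *)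
have ring_sep i j x y : (i.+1 < j)%N -> ring i x -> ring j y ->
    (i.+2%:R^-1 - j.+1%:R^-1 <= mdist x y)%R.
  move=> ij [[Ax xF] _] [[Ay _] nfar].
  have [z [Fz yz]] : exists z, F z /\ (mdist y z < j.+1%:R^-1)%R.
    apply: contrapT => nz; apply: nfar; split => // z Fz; rewrite leNgt.
    by apply/negP => yz; apply: nz; exists z.
  rewrite lerBlDr (le_trans (xF _ Fz))// (le_trans (metric_triangle x y z))//.
  by rewrite lerD2l ltW.
have ring_sum p n : \sum_(i < n) H (ring (i.*2 + p)%N) <=
    H (\big[setU/set0]_(i < n) ring (i.*2 + p)%N).
  elim: n => [|n IH]; first by rewrite !big_ord0 outer_measure0.
  rewrite !big_ord_recr/= (le_trans (leeD2r _ IH))//.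
  have [->|n0] := eqVneq n 0%N.
    by rewrite big_ord0 outer_measure0 add0e set0U.
  apply: (@hausdorff1_separated ((n.*2 + p)%:R^-1 - (n.*2 + p).+1%:R^-1)%R).
    by rewrite subr_gt0 ltf_pV2 ?posrE ?ltr_nat// ltr0n; lia.
  move=> x y; rewrite -(bigcup_mkord n (fun i => ring (i.*2 + p)%N)) => -[i /= ni rx] ry.
  apply: le_trans (ring_sep _ _ _ _ _ rx ry); last by lia.
  by rewrite lerD2r lef_pV2 ?posrE ?ler_nat// ?ltr0n; lia.
have ring_sumA p n : \sum_(i < n) H (ring (i.*2 + p)%N) <= H A.
  rewrite (le_trans (ring_sum p n))//; apply: le_outer_measure.
  by rewrite -(bigcup_mkord n (fun i => ring (i.*2 + p)%N)) => x [i _ [/farA]].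
have Hring0 n : 0 <= H (ring n) by exact: outer_measure_ge0.
(* The rings of even index and those of odd index each have a sum of measures at most [H A]. *)
have ring_fin : \sum_(0 <= n <oo) H (ring n) < +oo.
  apply: (@le_lt_trans _ _ (H A + H A)); last by rewrite lte_add_pinfty.
  apply: lime_le; first exact: is_cvg_nneseries.
  apply: nearW => n; apply: (@le_trans _ _ (\sum_(0 <= i < n.*2) H (ring i))).
    rewrite (@big_cat_nat _ _ _ n 0 n.*2)//=; last by lia.
    by rewrite leeDl// sume_ge0.
  rewrite (_ : \sum_(0 <= i < n.*2) H (ring i) =
      \sum_(i < n) H (ring (i.*2 + 0)%N) + \sum_(i < n) H (ring (i.*2 + 1)%N)).
    exact: leeD.
  rewrite -big_split/=; elim: n => [|n IH]; first by rewrite big_geq// big_ord0.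
  by rewrite doubleS !big_nat_recr//= IH big_ord_recr/= addn0 addn1 addeA.
have far_cover n : H (A `&` ~` F) <= H (far n) + \sum_(n <= k <oo) H (ring k).
  pose G k := if (k < n)%N then set0 else ring k.
  have -> : \sum_(n <= k <oo) H (ring k) = \sum_(0 <= k <oo) H (G k).
    rewrite [RHS](nneseries_split 0 n); last by move=> k _; exact: outer_measure_ge0.
    rewrite add0n big_nat big1 ?add0e => [|i /andP[_ ni]]; last first.
      by rewrite /G ni outer_measure0.
    rewrite [LHS]eseries_cond [RHS]eseries_cond.
    by apply: eq_eseriesr => i /andP[_ ni]; rewrite /G ltnNge ni.
  apply: le_trans (leeD2l _ (outer_measure_sigma_subadditive H G)).
  apply: le_trans (outer_measureU2 H _ _); apply: le_outer_measure => x [Ax nFx].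
  have /open_nbhs_nbhs/nbhs_ballP[e /= e0 xe] : open_nbhs x (~` F).
    by split => //; exact: closed_openC.
  have farx : exists m, far m x.
    exists (Num.truncn e^-1); split => // y Fy; rewrite leNgt; apply/negP => xy.
    apply: (xe y) => //; rewrite ballEmdist/= (lt_trans xy)// invf_plt ?posrE//.
    by rewrite truncnS_gt.
  have [fn|nfn] := pselect (far n x); [by left|right].
  (* The least [m] with [far m x] exceeds [n], which puts [x] in the ring of index [m.-1], a ring
     that the tail counts. *)
  have := ex_minnP (P := fun m => `[< far m x >]).
  have ex : exists m, `[< far m x >] by have [m ?] := farx; exists m; exact/asboolP.
  move=> /(_ ex)[m /asboolP fm mmin].
  have nm : (n < m)%N.
    rewrite ltnNge; apply/negP => mn; apply: nfn; split => // y Fy.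
    by rewrite (le_trans _ (fm.2 _ Fy))// lef_pV2 ?posrE// ler_nat.
  exists m.-1 => //; rewrite /G ltnNge (_ : (n <= m.-1)%N); last by lia.
  have m1 : m.-1.+1 = m by lia.
  split; first by rewrite m1.
  by move=> /asboolP/mmin; lia.
have tail0 : \sum_(n <= k <oo) H (ring k) @[n --> \oo] --> 0.
  by apply: nneseries_tail_cvg.
apply/lee_addgt0Pr => e e0.
have /fine_cvgP[tfin] := tail0.
move=> /cvgrPdist_lt/(_ _ e0) te.
near \oo => n.
apply: (@le_trans _ _ (H (A `&` F) + (H (far n) + \sum_(n <= k <oo) H (ring k)))).
  exact: leeD2l.
rewrite addeA; apply: leeD; first exact: far_sep.
have tn : (\sum_(n <= k <oo) H (ring k)) \is a fin_num by near: n.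
rewrite -(fineK tn) lee_fin ltW//; apply: le_lt_trans (ler_norm _) _.
by rewrite -normrN -sub0r; near: n.
Unshelve. all: by end_near. Qed.

Let Hb : set (borel X) -> \bar R := H.

Let hausdorff1_borel (A : set (borel X)) : measurable A -> H.-cara.-measurable A.
Proof.
apply: smallest_sub => /=.
  split => [|B mB|G mG].
  - exact: (@measurable0 _ (caratheodory_type H)).
  - by rewrite setTD; exact: (@measurableC _ (caratheodory_type H)).
  - exact: (@bigcupT_measurable _ (caratheodory_type H)).
move=> U oU; rewrite -(setCK U); apply: (@measurableC _ (caratheodory_type H)).
by apply: hausdorff1_caratheodory; exact: open_closedC.
Qed.

Let hausdorff1_semi_sigma_additive : semi_sigma_additive Hb.
Proof.
move=> G mG tG mUG.
exact: (@caratheodory_measure_sigma_additive R X H G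
  (fun i => hausdorff1_borel (mG i)) tG (hausdorff1_borel mUG)).
Qed.

HB.instance Definition _ := isMeasure.Build _ (borel X) R
  (@hausdorff1 R X : set (borel X) -> \bar R)
  (outer_measure0 H) (outer_measure_ge0 H) hausdorff1_semi_sigma_additive.

End HausdorffMeasure.

(** * Lipschitz images of sets of reals *)

(* The library's Lebesgue measure is the outer measure on all sets of reals;
   only its restriction to Borel sets carries the measure structure. *)
Section LebesgueOuterMeasure.
Context {R : realType}.
Local Open Scope ereal_scope.
Local Notation leb := (@lebesgue_measure R).
Implicit Types (S E : set R).

Lemma le_lebesgue S E : S `<=` E -> leb S <= leb E.
Proof. exact: (le_outer_measure (wlength idfun)^*%mu). Qed.

Lemma lebesgue_ge0 S : 0 <= leb S.
Proof. exact: (outer_measure_ge0 (wlength idfun)^*%mu). Qed.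

Lemma lebesgue_sub : sigma_subadditive leb.
Proof. exact: (outer_measure_sigma_subadditive (wlength idfun)^*%mu). Qed.

Lemma lebesgueU2 S E : leb (S `|` E) <= leb S + leb E.
Proof. exact: (outer_measureU2 (wlength idfun)^*%mu). Qed.

(** [S] is arbitrary: Caratheodory measurability of the [J i] makes the outer measure additive on
    the traces. *)
Lemma lebesgue_trivIset_le (J : (set R)^nat) S :
  (forall i, measurable (J i)) -> trivIset setT J ->
  \sum_(0 <= i <oo) leb (S `&` J i) <= leb S.
Proof.
move=> mJ tJ.
have mJ' i : (wlength idfun)^*%mu.-caratheodory (J i).
  exact: (@sub_caratheodory _ _ _ (wlength idfun) _ (mJ i)).
apply: le_trans (caratheodory_lime_le mJ' tJ S).
by rewrite leeDl// outer_measure_ge0.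
Qed.

Lemma lebesgue_le_diam S (b : R) : (0 <= b)%R ->
  (forall s t, S s -> S t -> (`|s - t| <= b)%R) -> leb S <= b%:E.
Proof.
move=> b0 Sb; have [[s Ss]|S0] := pselect (S !=set0); last first.
  rewrite (_ : S = set0) ?measure0 ?lee_fin//.
  by apply/eqP/negPn/negP => /set0P.
have lbS : lbound S (s - b)%R.
  by move=> t St; have := Sb _ _ Ss St; rewrite ler_norml => /andP[_]; lra.
have hlS : has_lbound S by exists (s - b)%R.
have SI : S `<=` `[inf S, (inf S + b)%R].
  move=> t St; rewrite /= in_itv/= ge_inf//=; apply/ler_addgt0Pr => e e0.
  have [u Su ut] := inf_adherent e0 (conj (ex_intro _ s Ss) hlS).
  by have := Sb _ _ St Su; rewrite ler_norml => /andP[_]; lra.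
rewrite (le_trans (le_lebesgue SI))// lebesgue_measure_itv/= lte_fin.
case: ifP => _; last by rewrite lee_fin.
by rewrite -EFinD lee_fin; lra.
Qed.

End LebesgueOuterMeasure.

Section LipschitzImages.
Context {R : realType} {X : completeMetricType R}.
Local Open Scope ereal_scope.
Local Notation leb := (@lebesgue_measure R).
Variable g : R -> X.

(** The images of the intervals of a Lebesgue cover, cut down to [E], form a Hausdorff cover; the
    width bound [w] keeps their diameters at most [d]. *)
Lemma hausdorff1_delta_lipschitz (E : set R) (c w d : R) :
    (0 <= c)%R -> (0 < d)%R -> (c * w <= d)%R ->
    (forall s t, E s -> E t -> (`|s - t| < w)%R) ->
    (forall s t, E s -> E t -> (mdist (g s) (g t) <= c * `|s - t|)%R) ->
  hausdorff1_delta d (g @` E) <= c%:E * leb E.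
Proof.
move=> c0 d0 cwd Ew Ec.
have dist_d s t : E s -> E t -> (mdist (g s) (g t) <= d)%R.
  move=> Es Et; rewrite (le_trans (Ec _ _ Es Et))// (le_trans _ cwd)//.
  by rewrite ler_wpM2l// ltW// Ew.
(* The rate 0 is treated apart, since the main case divides by [c]. *)
move: c0; rewrite le_eqVlt => /predU1P[c0|c0].
  rewrite -c0 mul0e; apply: (@le_trans _ _ (diam (g @` E))).
    apply: hausdorff1_delta_diam => //; apply: diam_le.
      by rewrite lee_fin ltW.
    by move=> _ _ [s Es <-] [t Et <-]; rewrite lee_fin dist_d.
  apply: diam_le => // _ _ [s Es <-] [t Et <-].
  by rewrite lee_fin (le_trans (Ec _ _ Es Et))// -c0 mul0r.
rewrite -lee_pdivrMl//; apply: le_ereal_inf_tmp => _ [F [mF EF] <-].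
rewrite lee_pdivrMl// -nneseriesZl; last by move=> i _; exact: wlength_ge0.
apply: (@le_trans _ _ (\sum_(0 <= i <oo) diam (g @` (E `&` F i)))).
  apply: ereal_inf_lbound; exists (fun i => g @` (E `&` F i)) => //; split.
    by move=> _ [s Es <-]; have [i _ Fs] := EF _ Es; exists i => //; exists s.
  move=> i; apply: diam_le; first by rewrite lee_fin ltW.
  by move=> _ _ [s [Es _] <-] [t [Et _] <-]; rewrite lee_fin dist_d.
apply: lee_nneseries => [i _ _|i _]; first exact: diam_ge0.
have [->|[[a b] /= ab Fab]] := (ocitvP (F i)).1 (mF i).
  by rewrite setI0 image_set0 diam_set0 mule_ge0// ?lee_fin ?wlength_ge0// ltW.
rewrite Fab wlength_itv_bnd ?(ltW ab)//= -EFinM; apply: diam_le.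
  by rewrite lee_fin mulr_ge0 ?subr_ge0// ltW.
move=> _ _ [s [Es /=]] + <- [t [Et /=]] + <-; rewrite !in_itv/= => sab tab.
rewrite lee_fin (le_trans (Ec _ _ Es Et))// ler_wpM2l ?(ltW c0)//.
by rewrite ler_norml; lra.
Qed.

(** On cells finer than [w] the Lipschitz bound holds for all pairs of points, and the traces of [E]
    on disjoint cells have total measure at most [leb E]. *)
Lemma hausdorff1_lipschitz (E : set R) (c w : R) : (0 <= c)%R -> (0 < w)%R ->
    (forall s t, E s -> E t -> (`|s - t| < w)%R ->
       (mdist (g s) (g t) <= c * `|s - t|)%R) ->
  hausdorff1 (g @` E) <= c%:E * leb E.
Proof.
move=> c0 w0 Ec; apply: hausdorff1_le_ub => d d0.
(* The second bound gives [c * e <= d]; the added 1 allows for [c = 0]. *)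
pose e := Num.min w (d / (c + 1))%R.
have c1 : (0 < c + 1)%R by lra.
have e0 : (0 < e)%R by rewrite lt_min w0 divr_gt0.
have ced : (c * e <= d)%R.
  apply: (@le_trans _ _ ((c + 1) * (d / (c + 1)))%R).
    apply: ler_pM => //; [exact: ltW|by rewrite lerDl|].
    by rewrite ge_min lexx orbT.
  by rewrite mulrCA divff ?mulr1// gt_eqF.
pose cell (s : R) := choice.pickle (Num.floor (s / e)).
pose J i := [set s | cell s = i].
have cellP (z : int) s : Num.floor (s / e) = z <-> (z%:~R * e <= s < (z + 1)%:~R * e)%R.
  split => [<-|zs]; first by rewrite -ler_pdivlMr// -ltr_pdivrMr// floor_itv.
  by apply: floor_def; rewrite ler_pdivlMr// ltr_pdivrMr.
have mJ i : measurable (J i).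
  have [[z zi]|nz] := pselect (exists z : int, choice.pickle z = i).
    rewrite (_ : J i = `[(z%:~R * e)%R, ((z + 1)%:~R * e)%R[%classic)//.
    apply/seteqP; split => s /=; rewrite in_itv/=.
      by rewrite /J/= -zi => /(pcan_inj choice.pickleK)/cellP.
    by move=> /cellP; rewrite -zi /J/= /cell => ->.
  rewrite (_ : J i = set0)//.
  by rewrite -subset0 => s Js; apply: nz; exists (Num.floor (s / e)).
have tJ : trivIset setT J.
  by move=> i j _ _ [s [<- <-]].
have Jw i s t : J i s -> J i t -> (`|s - t| < e)%R.
  rewrite /J/= => <- /(pcan_inj choice.pickleK)/cellP.
  have /cellP := erefl (Num.floor (s / e)); rewrite intrD mulrDl mul1r.
  set x := (_ * e)%R; move=> sx tx.
  by rewrite ltr_norml; lra.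
apply: (@le_trans _ _ (\sum_(0 <= i <oo) hausdorff1_delta d (g @` (E `&` J i)))).
  apply: le_trans (hausdorff1_delta_sub _ _); apply: hausdorff1_delta_le.
  by move=> _ [s Es <-]; exists (cell s) => //; exists s.
apply: le_trans (lee_wpmul2l _ (lebesgue_trivIset_le E mJ tJ)); last by rewrite lee_fin.
rewrite -nneseriesZl; last by move=> i _; exact: lebesgue_ge0.
apply: lee_nneseries => [i _ _|i _]; first exact: hausdorff1_delta_ge0.
apply: (@hausdorff1_delta_lipschitz _ _ e) => //.
  by move=> s t [_ Js] [_ Jt]; exact: Jw Js Jt.
move=> s t [Es Js] [Et Jt]; apply: Ec => //.
by rewrite (lt_le_trans (Jw _ _ _ Js Jt))// ge_min lexx.
Qed.

(** A set of diameter r has a preimage in [B] of diameter, hence of outer measure, at most r/c. The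
    single scale 1 suffices for a lower bound and makes all diameters of the cover finite. *)
Lemma hausdorff1_expanding (B : set R) (c : R) : (0 < c)%R ->
    (forall s t, B s -> B t -> (c * `|s - t| <= mdist (g s) (g t))%R) ->
  c%:E * leb B <= hausdorff1 (g @` B).
Proof.
move=> c0 Bc; apply: le_trans (hausdorff1_delta_le_hausdorff1 _ ltr01).
apply: le_ereal_inf_tmp => _ [G [BG G1] <-].
have diam_fin i : diam (G i) = (fine (diam (G i)))%:E.
  rewrite fineK// ge0_fin_numE ?diam_ge0//.
  by rewrite (le_lt_trans (G1 i))// ltry.
rewrite -lee_pdivlMl// -nneseriesZl; last by move=> i _; exact: diam_ge0.
apply: (@le_trans _ _ (\sum_(0 <= i <oo) leb (B `&` g @^-1` G i))).
  apply: le_trans (lebesgue_sub _); apply: le_lebesgue => s Bs.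
  by have [i _ Gs] := BG (g s) (imageP _ Bs); exists i.
apply: lee_nneseries => [i _ _|i _]; first exact: lebesgue_ge0.
rewrite diam_fin -EFinM; apply: lebesgue_le_diam.
  by rewrite mulr_ge0 ?invr_ge0 ?(ltW c0)// -lee_fin -diam_fin diam_ge0.
move=> s t [Bs Gs] [Bt Gt]; rewrite ler_pdivlMl// (le_trans (Bc _ _ Bs Bt))//.
by rewrite -lee_fin -diam_fin; exact: mdist_le_diam.
Qed.

End LipschitzImages.

(** * Closed sets of points with controlled slope *)

Section Slopes.
Context {R : realType} {X : completeMetricType R}.
Variables (C : set R) (g : R -> X).
Hypotheses (cC : closed C) (lipg : @metric_lipschitz R R^o X C g).
Local Notation leb := (@lebesgue_measure R).

(** Bounding the slope from one base point at a uniform scale gives closed sets, increasing in [n];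
    conditions on the local slope thereby become Borel conditions. *)
Definition slope_le (c : R) (n : nat) := [set t | C t /\
  forall s, C s -> `|s - t| < n.+1%:R^-1 -> mdist (g s) (g t) <= c * `|s - t|].

Definition slope_ge (c : R) (n : nat) := [set t | C t /\
  forall s, C s -> `|s - t| < n.+1%:R^-1 -> c * `|s - t| <= mdist (g s) (g t)].

Lemma fragment_lipschitz : exists2 K : R, 0 < K &
  forall s t, C s -> C t -> mdist (g s) (g t) <= K * `|s - t|.
Proof.
have [K gK] := lipg; exists (Num.max K 1); first by rewrite lt_max ltr01 orbT.
move=> s t Cs Ct; rewrite (le_trans (gK _ _ Cs Ct))//.
by rewrite [mdist _ _]distrC ler_wpM2r// le_max lexx.
Qed.

Lemma closure_near (S : set R) t e : closure S t -> 0 < e ->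
  exists2 u, S u & `|u - t| < e.
Proof.
move=> St e0; have [u [Su tu]] := St _ (nbhsx_ballx t e e0).
by exists u => //; rewrite distrC.
Qed.

Lemma slope_near (S : set R) (n : nat) t s : closure S t ->
  `|s - t| < n.+1%:R^-1 -> forall e, 0 < e ->
  exists2 u, S u & `|u - t| < e /\ `|s - u| < n.+1%:R^-1.
Proof.
move=> St sn e e0.
have m0 : 0 < Num.min e (n.+1%:R^-1 - `|s - t|) by rewrite lt_min e0 subr_gt0.
have [u Su] := closure_near St m0; rewrite lt_min => /andP[ue un].
exists u => //; split => //.
rewrite (le_lt_trans (ler_distD t _ _))// (distrC t).
by move: un; rewrite ltrBrDl.
Qed.

(** The scale inequality is strict, so it persists for points [u] of the set near [t]; the Lipschitz
    bound then carries the slope inequality from [u] to [t]. *)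
Lemma closed_slope_le c n : closed (slope_le c n).
Proof.
have [K K0 gK] := fragment_lipschitz.
move=> t St; have Ct : C t.
  by apply: cC; apply: closure_subset St => u [].
split => // s Cs sn; apply/ler_addgt0Pr => e e0.
(* Replacing [u] by [t] costs K|u - t| in the distance and |c||u - t| on the right-hand side,
   together at most [e]. *)
have eK : 0 < e / (`|c| + K) by rewrite divr_gt0// ltr_wpDl.
have [u [Cu uc] [ut su]] := slope_near St sn eK.
rewrite (le_trans (metric_triangle _ (g u) _))//.
have := uc _ Cs su; have := gK _ _ Cu Ct.
have : c * `|s - u| <= c * `|s - t| + `|c| * `|u - t|.
  rewrite -lerBlDl -mulrBr (le_trans (ler_norm _))// normrM ler_wpM2l//.
  rewrite (le_trans (ler_dist_dist _ _))// (_ : s - u - (s - t) = t - u).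
    by rewrite distrC.
  by ring.
have : (`|c| + K) * `|u - t| <= e by rewrite mulrC -ler_pdivlMr ?ltr_wpDl// ltW.
by lra.
Qed.

Lemma closed_slope_ge c n : closed (slope_ge c n).
Proof.
have [K K0 gK] := fragment_lipschitz.
move=> t St; have Ct : C t.
  by apply: cC; apply: closure_subset St => u [].
split => // s Cs sn; apply/ler_addgt0Pr => e e0.
have eK : 0 < e / (`|c| + K) by rewrite divr_gt0// ltr_wpDl.
have [u [Cu uc] [ut su]] := slope_near St sn eK.
have := metric_triangle (g s) (g t) (g u); have := gK _ _ Ct Cu.
have := uc _ Cs su; rewrite (distrC t).
have : c * `|s - t| <= c * `|s - u| + `|c| * `|u - t|.
  rewrite -lerBlDl -mulrBr (le_trans (ler_norm _))// normrM ler_wpM2l//.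
  rewrite (le_trans (ler_dist_dist _ _))// (_ : s - t - (s - u) = u - t)//.
  by ring.
have : (`|c| + K) * `|u - t| <= e by rewrite mulrC -ler_pdivlMr ?ltr_wpDl// ltW.
by lra.
Qed.

(** On each increment of the sequence [slope_le c] the slope bound holds at one common scale, so the
    Lipschitz estimate applies there; the increments are then summed. *)
Lemma hausdorff1_slope_le (E : set R) c : 0 <= c -> measurable E ->
  E `<=` \bigcup_n slope_le c n -> (hausdorff1 (g @` E) <= c%:E * leb E)%E.
Proof.
move=> c0 mE EC.
have mS n : measurable (slope_le c n).
  by apply: closed_measurable; exact: closed_slope_le.
have ndS : {homo slope_le c : n m / (n <= m)%N >-> (n <= m)%O}.
  move=> n m nm; apply/subsetPset => t [Ct ct]; split => // s Cs sm.
  by apply: ct => //; rewrite (lt_le_trans sm)// lef_pV2 ?posrE// ler_nat.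
pose J := seqD (slope_le c).
have mJ i : measurable (J i) by case: i => [|i] /=; [|exact: measurableD].
have tJ : trivIset setT J by exact: trivIset_seqD.
apply: (@le_trans _ _ (\sum_(0 <= i <oo) hausdorff1 (g @` (E `&` J i)))%E).
  apply: le_trans (outer_measure_sigma_subadditive (@hausdorff1 R X) _).
  apply: le_outer_measure => _ [s Es <-].
  have : (\bigcup_i J i) s by rewrite eq_bigcup_seqD; exact: EC.
  by move=> [i _ Js]; exists i => //; exists s.
apply: le_trans (lee_wpmul2l _ (lebesgue_trivIset_le E mJ tJ)); last by rewrite lee_fin.
rewrite -nneseriesZl; last by move=> i _; exact: lebesgue_ge0.
apply: lee_nneseries => [i _ _|i _]; first exact: outer_measure_ge0.
apply: (@hausdorff1_lipschitz _ _ _ _ _ i.+1%:R^-1) => //.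
have JS : J i `<=` slope_le c i by case: i => [|i] //= t [].
by move=> s t [_ /JS[Cs _]] [_ /JS[_ ct]] st; exact: ct.
Qed.

End Slopes.

(** * Increments of real Lipschitz functions and derivatives along fragments *)

(* The estimates for fragments in a complete metric space are applied below to
   real functions. *)
HB.instance Definition _ (R : realType) := Metric.on R^o.
HB.instance Definition _ (R : realType) := Complete.on R^o.

Section RealFunctions.
Context {R : realType}.
Local Notation leb := (@lebesgue_measure R).

(** The intermediate value theorem will be applied on a whole interval, while [h] is controlled on
    [C] only. *)
Lemma mcshane_extension (C : set R) (h : R -> R) (K : R) : C !=set0 -> 0 <= K ->
    (forall s t, C s -> C t -> `|h s - h t| <= K * `|s - t|) ->
  exists2 f : R -> R, {in C, f =1 h} &
    forall s t, `|f s - f t| <= K * `|s - t|.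
Proof.
move=> [c Cc] K0 hK; pose P s := [set h u + K * `|s - u| | u in C].
have lbP s : lbound (P s) (h c - K * `|s - c|).
  move=> _ [u Cu <-]; have := hK _ _ Cc Cu; rewrite ler_norml => /andP[_].
  have := ler_wpM2l K0 (ler_distD s c u); rewrite mulrDr (distrC c s).
  by lra.
have hP s : has_lbound (P s) by exists (h c - K * `|s - c|).
have P0 s : P s !=set0 by exists (h c + K * `|s - c|), c.
have le_inf s t : inf (P s) <= inf (P t) + K * `|s - t|.
  rewrite -lerBlDr; apply: lb_le_inf => // _ [u Cu <-]; rewrite lerBlDr.
  apply: (le_trans (ge_inf (hP s) (ex_intro2 _ _ u Cu erefl))).
  by rewrite -addrA lerD2l -mulrDr ler_wpM2l// (addrC `|t - u|) ler_distD.
exists (fun s => inf (P s)).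
  move=> s /set_mem Cs; apply/eqP; rewrite eq_le; apply/andP; split.
    by apply: ge_inf => //; exists s => //; rewrite subrr normr0 mulr0 addr0.
  apply: lb_le_inf => // _ [u Cu <-]; have := hK _ _ Cs Cu.
  by rewrite ler_norml => /andP[_]; lra.
move=> s t; have := le_inf s t; have := le_inf t s.
by rewrite (distrC t s) ler_norml; lra.
Qed.

Lemma lebesgue_le_hausdorff1 (E : set R) :
  (leb E <= @hausdorff1 R R^o E)%E.
Proof.
have := @hausdorff1_expanding R R^o id E 1 ltr01.
by rewrite mul1e image_id; apply => s t _ _; rewrite mul1r [leRHS]distrC.
Qed.

(** Every value between [h a] and [h b] is taken by the extended function, either on [E], where the
    local slope is at most [c], or on the rest of the interval, where it is [K]-Lipschitz. *)
Lemma lipschitz_increment (C E : set R) (h : R -> R) (K c a b : R) :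
    closed C -> 0 <= K -> 0 <= c ->
    (forall s t, C s -> C t -> `|h s - h t| <= K * `|s - t|) ->
    a <= b -> C a -> C b -> measurable E -> E `<=` `[a, b] ->
    E `<=` \bigcup_n @slope_le R R^o C h c n ->
  (`|h b - h a|%:E <= c%:E * leb E + K%:E * leb (`[a, b] `\` E))%E.
Proof.
move=> cC K0 c0 hK ab Ca Cb mE Eab ES.
have [f fh fK] := mcshane_extension (ex_intro _ a Ca) K0 hK.
have cf : {within `[a, b], continuous f}.
  apply: continuous_subspaceT => s; apply/cvgrPdist_le => e e0.
  exists (e / (K + 1)) => /= [|t /= st]; first by rewrite divr_gt0 ?ltr_wpDl.
  rewrite (le_trans (fK _ _))// (@le_trans _ _ ((K + 1) * `|s - t|))//.
    by rewrite ler_wpM2r// lerDl.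
  by rewrite mulrC -ler_pdivlMr ?ltr_wpDl// ltW.
have fa : f a = h a by apply: fh; exact: mem_set.
have fb : f b = h b by apply: fh; exact: mem_set.
have EC : E `<=` C by move=> s /ES[n _ []].
have img : `[Num.min (h a) (h b), Num.max (h a) (h b)]%classic `<=`
    (h @` E) `|` (f @` (`[a, b] `\` E)).
  move=> v; rewrite /= in_itv/= -fa -fb => vab.
  have [s sab fs] := IVT ab cf vab; have [Es|nEs] := pselect (E s).
    by left; exists s => //; rewrite -fs fh//; apply: mem_set; exact: EC.
  by right; exists s => //; split.
have -> : `|h b - h a|%:E =
    leb `[Num.min (h a) (h b), Num.max (h a) (h b)]%classic.
  case: (leP (h a) (h b)) => hab; rewrite lebesgue_measure_itv/= lte_fin.
    rewrite ger0_norm ?subr_ge0//; case: ltP => [//|hba]; congr (_%:E).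
    by apply/eqP; rewrite subr_eq0 eq_le hab hba.
  by rewrite hab ltr0_norm ?subr_lt0// opprB.
apply: (le_trans (le_lebesgue img)); apply: (le_trans (lebesgueU2 _ _)).
apply: leeD; apply: (le_trans (lebesgue_le_hausdorff1 _)).
  apply: (@hausdorff1_slope_le R R^o C h) => //.
  by exists K => s t Cs Ct; rewrite ![mdist _ _]distrC hK.
apply: (@hausdorff1_lipschitz R R^o f _ K 1) => // s t _ _ _.
by rewrite [leLHS]distrC.
Qed.

End RealFunctions.

(** * Derivatives along a closed set and the chain rule *)

Section FragmentDerivatives.
Context {R : realType}.
Implicit Types (C : set R) (u : R -> R).

Lemma near_dist_lt (t e : R) : 0 < e -> \forall s \near t, `|s - t| < e.
Proof. by move=> e0; exists e => // s /=; rewrite distrC. Qed.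

(** The derivative in product form, free of quotients and limits. It determines [a] where [t] is a
    limit point of [C]. *)
Definition is_frag_derive C u t a := forall e : R, 0 < e ->
  \forall s \near t, C s -> `|u s - u t - a * (s - t)| <= e * `|s - t|.

Lemma frag_derivableP C u t : frag_derivable C u t ->
  is_frag_derive C u t (frag_derive C u t).
Proof.
move=> [_ _ /cvgrPdist_le du] e e0.
have := du _ e0; rewrite near_withinE /dnbhs near_withinE.
apply: filterS => s sq Cs; have [->|st] := eqVneq s t.
  by rewrite !subrr mulr0 subrr !normr0 mulr0.
have := sq st Cs; rewrite distrC -/(frag_derive C u t).
set a := frag_derive C u t => qa.
have st0 : s - t != 0 by rewrite subr_eq0.
rewrite (_ : _ - _ = ((u s - u t) / (s - t) - a) * (s - t)); last by field.
by rewrite normrM ler_wpM2r.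
Qed.

Lemma is_frag_derive_unique C u t a b : limit_point C t ->
  is_frag_derive C u t a -> is_frag_derive C u t b -> a = b.
Proof.
move=> lt ua ub; apply/eqP; rewrite -subr_eq0 -normr_le0.
apply/ler_addgt0Pr => e e0; rewrite add0r.
have e2 : 0 < e / 2 by rewrite divr_gt0.
have [s [st Cs [sa sb]]] := lt _ (filterI (ua _ e2) (ub _ e2)).
have st0 : 0 < `|s - t| by rewrite normr_gt0 subr_eq0.
rewrite -(ler_pM2r st0) -normrM.
rewrite (_ : (a - b) * (s - t) =
  (u s - u t - b * (s - t)) - (u s - u t - a * (s - t))); last by ring.
rewrite (le_trans (ler_normB _ _))// (le_trans (lerD (sb Cs) (sa Cs)))//.
by rewrite -mulrDl -splitr.
Qed.

Lemma is_frag_derive_bound C u t a K : limit_point C t -> C t ->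
    (forall s, C s -> `|u s - u t| <= K * `|s - t|) ->
  is_frag_derive C u t a -> `|a| <= K.
Proof.
move=> lt Ct uK ua; apply/ler_addgt0Pr => e e0.
have [s [st Cs sa]] := lt _ (ua _ e0).
have st0 : 0 < `|s - t| by rewrite normr_gt0 subr_eq0.
rewrite -(ler_pM2r st0) -normrM mulrDl.
rewrite (_ : a * (s - t) = (u s - u t) - (u s - u t - a * (s - t))); last by ring.
by rewrite (le_trans (ler_normB _ _))// lerD// ?uK// sa.
Qed.

Context {X : completeMetricType R}.

(** Half of the error [e] goes to the expansion of [f] in the chart, where [K] turns distances into
    |s - t|; the other half goes to the coordinates, weighted by the coefficients, whose total is
    below [M]. *)
Lemma is_frag_derive_chain C (g : R -> X) t n (phi : 'I_n -> X -> R) f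
    (c v : 'rV[R]_n) :
  @metric_lipschitz R R^o X C g -> C t -> is_differential phi f (g t) c ->
  (forall i, is_frag_derive C (phi i \o g) t (v 0 i)) ->
  is_frag_derive C (f \o g) t (pairing c v).
Proof.
move=> lipg Ct /eqoP df dphi e e0.
have [K K0 gK] := fragment_lipschitz lipg.
pose M := \sum_i `|c 0 i| + 1.
have M0 : 0 < M by rewrite ltr_wpDl// sumr_ge0.
have eK : 0 < e / 2 / K by rewrite !divr_gt0.
have eM : 0 < e / 2 / M by rewrite !divr_gt0.
have /nbhs_ballP[r /= r0 rdf] := df _ eK.
have near_i := @filter_forall R 'I_n _ (nbhs t) (nbhs_filter t) (fun i => dphi i _ eM).
have near_r : \forall s \near t, `|s - t| < r / K.
  by apply: near_dist_lt; rewrite divr_gt0.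
apply: filterS2 near_i near_r => s si sr Cs.
have gr : ball (g t) r (g s).
  rewrite ballEmdist/= metric_sym (le_lt_trans (gK _ _ Cs Ct))// mulrC.
  by rewrite -ltr_pdivlMr.
have /= := rdf _ gr; rewrite /dist_from/=.
rewrite (ger0_norm (mdist_ge0 _ _)) => dfs.
have {}dfs : `|f (g s) - f (g t) - \sum_i c 0 i * (phi i (g s) - phi i (g t))|
    <= e / 2 * `|s - t|.
  apply: (le_trans dfs); rewrite -[leLHS]mulrA ler_wpM2l ?divr_ge0 ?(ltW e0)//.
  by rewrite ler_pdivrMl// gK.
have dps : `|\sum_i c 0 i * (phi i (g s) - phi i (g t)) -
    pairing c v * (s - t)| <= e / 2 * `|s - t|.
  rewrite /pairing mulr_suml -sumrB.
  apply: (@le_trans _ _ (\sum_i `|c 0 i| * (e / 2 / M * `|s - t|))).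
    rewrite (le_trans (ler_norm_sum _ _ _))//; apply: ler_sum => i _.
    rewrite -mulrA -mulrBr normrM ler_wpM2l//.
    exact: si.
  rewrite -mulr_suml mulrA ler_wpM2r// mulrCA ler_piMr ?divr_ge0 ?(ltW e0)//.
  by rewrite ler_pdivrMr// mul1r /M lerDl.
rewrite /= (_ : f (g s) - _ - _ =
  (f (g s) - f (g t) - \sum_i c 0 i * (phi i (g s) - phi i (g t))) +
  (\sum_i c 0 i * (phi i (g s) - phi i (g t)) - pairing c v * (s - t))); last by ring.
by rewrite (le_trans (ler_normD _ _))// (le_trans (lerD dfs dps))// -mulrDl -splitr.
Qed.

End FragmentDerivatives.

(** * Metric differentiability at generic points *)

Section MetricDifferentiability.
Context {R : realType} {X : completeMetricType R}.
Local Notation leb := (@lebesgue_measure R).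
Implicit Types (C E : set R) (D : set X).

Lemma density_point_ge E t e : density_point E t -> 0 < e ->
  \forall r \near 0^'+, (((1 - e) * (r *+ 2))%:E <= leb (E `&` ball t r))%E.
Proof.
move=> /fine_cvgP[fin /cvgrPdist_le/(_ e)] dE e0; have {}dE := dE e0.
near=> r; have r0 : 0 < r by near: r; exact: nbhs_right_gt.
have r2 : 0 < r *+ 2 by rewrite mulrn_wgt0.
have : ((leb (E `&` ball t r) * (leb (ball t r))^-1)%E \is a fin_num) by near: r.
have : `|1 - fine (leb (E `&` ball t r) * (leb (ball t r))^-1)%E| <= e by near: r.
rewrite lebesgue_measure_ball ?(ltW r0)// inver gt_eqF//.
have Er : (leb (E `&` ball t r) <= (r *+ 2)%:E)%E.
  by rewrite -(lebesgue_measure_ball t (ltW r0)) le_lebesgue.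
have Efin : leb (E `&` ball t r) \is a fin_num.
  by rewrite ge0_fin_numE ?lebesgue_ge0// (le_lt_trans Er) ?ltry.
rewrite -(fineK Efin) -EFinM/= ler_norml => /andP[_ le] _.
by rewrite lee_fin -ler_pdivlMr//; lra.
Unshelve. all: by end_near. Qed.

Lemma dense_near D x e : dense D -> 0 < e -> exists2 y, D y & mdist y x < e.
Proof.
move=> dD e0; have [||y [xy Dy]] := dD (ball x e)°.
- by exists x; exact: nbhsx_ballx.
- exact: open_interior.
by exists y => //; move/interior_subset : xy; rewrite ballEmdist/= metric_sym.
Qed.

Lemma dist_from_lipschitz (x y z : X) :
  `|dist_from x y - dist_from x z| <= mdist y z.
Proof.
have := metric_triangle y z x; have := metric_triangle z y x.
by rewrite /dist_from (metric_sym z y) ler_norml; lra.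
Qed.

Variables (C : set R) (g : R -> X) (D : set X) (t : R).
Hypotheses (cC : closed C) (lipg : @metric_lipschitz R R^o X C g).
Hypotheses (dD : dense D) (Ct : C t).
Hypothesis derD : forall x, D x -> frag_derivable C (dist_from x \o g) t.
Let c := dist_speed C g D t.
Let speed (s : R) := [set `|frag_derive C (dist_from x \o g) s| | x in D].

Lemma dense_neq0 : D !=set0.
Proof. by have [y Dy _] := dense_near (g t) dD ltr01; exists y. Qed.

Lemma speed_limit_point : limit_point C t.
Proof. by have [x /derD[]] := dense_neq0. Qed.

Lemma speed_has_sup s :
  (forall x, D x -> frag_derivable C (dist_from x \o g) s) -> has_sup (speed s).
Proof.
move=> ders; have [K K0 gK] := fragment_lipschitz lipg.
have [x Dx] := dense_neq0; split.
  by exists `|frag_derive C (dist_from x \o g) s|; exists x.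
exists K => _ [y Dy <-]; have [Cs ls _] := ders _ Dy.
apply: (is_frag_derive_bound ls Cs _ (frag_derivableP (ders _ Dy))) => u Cu /=.
by rewrite (le_trans (dist_from_lipschitz _ _ _))// gK.
Qed.

Lemma dist_speed_ge0 : 0 <= c.
Proof.
have [x Dx] := dense_neq0.
apply: le_trans (normr_ge0 (frag_derive C (dist_from x \o g) t)) _.
by apply: ub_le_sup; [exact: (speed_has_sup derD).2|exists x].
Qed.

Lemma fragment_dist_ge e : 0 < e -> \forall d \near 0^'+, forall s1 s2,
  C s1 -> C s2 -> `|s1 - t| <= d -> `|s2 - t| <= d ->
  c * `|s1 - s2| - e * d <= mdist (g s1) (g s2).
Proof.
(* Two derivative errors of [e1 * d] each, plus the defect [e1] of the supremum times |s1 - s2|,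
   which is at most 2d. *)
move=> e0; pose e1 := e / 4; have e10 : 0 < e1 by rewrite divr_gt0.
have [_ [x Dx <-] xc] := sup_adherent e10 (speed_has_sup derD).
set a := frag_derive _ _ _ in xc.
have [r /= r0 ra] := frag_derivableP (derD Dx) e10.
near=> d => s1 s2 Cs1 Cs2 sd1 sd2.
have dr : d < r by near: d; exact: nbhs_right_lt.
have der s : C s -> `|s - t| <= d ->
    `|dist_from x (g s) - dist_from x (g t) - a * (s - t)| <= e1 * d.
  move=> Cs sd; apply: le_trans (ra s _ Cs) _.
    by rewrite /ball_/= distrC (le_lt_trans sd).
  by rewrite ler_wpM2l// ltW.
apply: le_trans (dist_from_lipschitz x _ _).
have dd := lerD (der _ Cs1 sd1) (der _ Cs2 sd2).
have : `|a| * `|s1 - s2| <=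
    `|dist_from x (g s1) - dist_from x (g s2)| + (e1 * d + e1 * d).
  apply: le_trans (lerD (lexx _) dd); rewrite -normrM.
  apply: le_trans (lerD (lexx _) (ler_normB _ _)).
  rewrite -[X in _ <= _ + X]normrN; apply: le_trans (ler_normD _ _).
  by rewrite [leRHS](_ : _ = `|a * (s1 - s2)|)//; congr (`|_|); ring.
have s12 : `|s1 - s2| <= d + d.
  by apply: (le_trans (ler_distD t _ _)); rewrite (distrC t) lerD.
have -> : c = sup (speed t) by [].
have := ler_wpM2r (normr_ge0 (s1 - s2)) (ltW xc).
have := ler_wpM2l (ltW e10) s12; rewrite mulrBl.
have -> : e = e1 * 4 by rewrite /e1; field.
by lra.
Unshelve. all: by end_near. Qed.

Hypothesis apx : forall e, 0 < e ->
  density_point [set s | (C `&` \bigcap_(x in D) frag_derivable C (dist_from x \o g)) s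
     /\ `|dist_speed C g D s - c| < e] t.

Lemma fragment_dist_le e : 0 < e -> \forall d \near 0^'+, forall s1 s2,
  C s1 -> C s2 -> `|s1 - t| <= d -> `|s2 - t| <= d ->
  mdist (g s1) (g s2) <= c * `|s1 - s2| + e * d.
Proof.
move=> e0; have [K K0 gK] := fragment_lipschitz lipg.
(* The excess slope costs 2 e1 (s2 - s1), at most 4 e1 d, and the bad set costs 4 K e1 d; these add
   up to e d. *)
pose e1 := e / (4 * (1 + K)).
have e10 : 0 < e1 by rewrite divr_gt0// mulr_gt0// ltr_wpDl.
have c0 := dist_speed_ge0; have ce0 : 0 <= c + 2 * e1 by lra.
pose G r :=
  [set s | (C `&` \bigcap_(x in D) frag_derivable C (dist_from x \o g)) s
     /\ `|dist_speed C g D s - c| < r].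
have dG : \forall r \near 0^'+,
    (((1 - e1) * (r *+ 2))%:E <= leb (G e1 `&` ball t r))%E.
  exact: density_point_ge (apx e10) e10.
have {dG}[r /= r0 dG] := dG.
near=> d => s1 s2; wlog s12 : s1 s2 / s1 <= s2.
  move=> wlg Cs1 Cs2 sd1 sd2; have [s12|/ltW s21] := leP s1 s2; first exact: wlg.
  by rewrite metric_sym distrC; exact: wlg.
move=> Cs1 Cs2 sd1 sd2.
have d0 : 0 < d by near: d; exact: nbhs_right_gt.
(* The radius 2d makes the open ball around [t] contain the closed interval from [s1] to [s2]. *)
have dr : d * 2 < r.
  by rewrite -ltr_pdivlMr//; near: d; apply: nbhs_right_lt; rewrite divr_gt0.
have d20 : 0 < d * 2 by rewrite mulr_gt0.
have {}dG : (((1 - e1) * ((d * 2) *+ 2))%:E <= leb (G e1 `&` ball t (d * 2)))%E.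
  by apply: dG => //=; rewrite sub0r normrN gtr0_norm.
have incr x : D x -> `|dist_from x (g s2) - dist_from x (g s1)| <=
    (c + 2 * e1) * (s2 - s1) + K * (e1 * (d * 4)).
  (* [S] is a Borel set containing [G e1]: there the derivative is at most [c + e1] in absolute
     value, and a further [e1] turns this into a bound on difference quotients at some scale. The
     measure bound below does not depend on [x]. *)
  move=> Dx; pose S := \bigcup_n @slope_le R R^o C (dist_from x \o g) (c + 2 * e1) n.
  have gxK u v : C u -> C v ->
      `|(dist_from x \o g) u - (dist_from x \o g) v| <= K * `|u - v|.
    by move=> Cu Cv; rewrite (le_trans (dist_from_lipschitz _ _ _))// gK.
  have mS : measurable S.
    apply: bigcupT_measurable => n; apply: closed_measurable.
    apply: closed_slope_le => //; exists K => u v Cu Cv.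
    by rewrite ![mdist _ _]distrC gxK.
  have GS : G e1 `<=` S.
    move=> s [[Cs ders] sc].
    have ders' y : D y -> frag_derivable C (dist_from y \o g) s by exact: ders.
    have as_le : `|frag_derive C (dist_from x \o g) s| <= c + e1.
      apply: (@le_trans _ _ (dist_speed C g D s)).
        by apply: ub_le_sup; [exact: (speed_has_sup ders').2|exists x].
      by move: sc; rewrite ltr_norml => /andP[_]; lra.
    have [m /= m0 ma] := frag_derivableP (ders' _ Dx) e10.
    exists (Num.truncn m^-1) => //; split => // u Cu us.
    have um : `|u - s| < m.
      by rewrite (lt_trans us)// invf_plt ?posrE// truncnS_gt.
    have := ma u; rewrite /ball_/= distrC => /(_ um Cu) dus.
    rewrite [leLHS]distrC.
    set b := frag_derive _ _ _ in as_le dus.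
    rewrite (_ : _ - _ = (dist_from x (g u) - dist_from x (g s) - b * (u - s)) +
      b * (u - s)); last by ring.
    rewrite (le_trans (ler_normD _ _))// (le_trans (lerD dus (lexx _)))//.
    rewrite normrM -mulrDl ler_wpM2r//; lra.
  have ballS : (leb (ball t (d * 2) `\` S) <= (e1 * (d * 4))%:E)%E.
    rewrite -(leeD2rE (x := leb (ball t (d * 2) `&` S))); last first.
      rewrite ge0_fin_numE ?lebesgue_ge0//.
      apply: (le_lt_trans (le_lebesgue (@subIsetl _ _ _))).
      by rewrite lebesgue_measure_ball ?(ltW d20)// ltry.
    have <- : leb (ball t (d * 2)) =
        (leb (ball t (d * 2) `\` S) + leb (ball t (d * 2) `&` S))%E.
      by apply: measureDI => //; exact: measurable_ball.
    rewrite lebesgue_measure_ball ?(ltW d20)//.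
    apply: (@le_trans _ _ ((e1 * (d * 4))%:E + ((1 - e1) * (d * 2 *+ 2))%:E)%E).
      by rewrite -EFinD lee_fin; lra.
    rewrite leeD2l// (le_trans dG)// setIC; apply: le_lebesgue.
    by move=> s [? ?]; split => //; exact: GS.
  have s12b : `[s1, s2] `<=` ball t (d * 2).
    move=> s; rewrite /= in_itv/= /ball/=; move: sd1 sd2.
    by rewrite !ler_norml ltr_norml; lra.
  have := @lipschitz_increment R C (S `&` `[s1, s2]) (dist_from x \o g) K
    (c + 2 * e1) s1 s2 cC (ltW K0) ce0 gxK s12 Cs1 Cs2.
  have mS12 : measurable (S `&` `[s1, s2]%classic) by exact: measurableI.
  have SS : S `&` `[s1, s2] `<=` S by exact: subIsetl.
  move=> /(_ mS12 (@subIsetr _ _ _) SS) incr; rewrite -lee_fin; apply: (le_trans incr).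
  rewrite [leRHS]EFinD; apply: leeD; rewrite [leRHS]EFinM; apply: lee_wpmul2l.
  - by rewrite lee_fin.
  - apply: lebesgue_le_diam; first by rewrite subr_ge0.
    move=> u v [_ /=] + [_ /=]; rewrite !in_itv/= => us vs.
    by rewrite ler_norml; lra.
  - by rewrite lee_fin ltW.
  - apply: le_trans ballS; apply: le_lebesgue => s [s12s nS]; split.
      exact: s12b.
    by move=> Ss; apply: nS.
(* For [x] in [D] close to [g s2], the increment of [dist_from x] nearly equals the distance from
   [g s1] to [g s2]. *)
have step : mdist (g s1) (g s2) <=
    (c + 2 * e1) * (s2 - s1) + K * (e1 * (d * 4)).
  apply/ler_addgt0Pr => m m0; have m2 : 0 < m / 2 by rewrite divr_gt0.
  have [x Dx xm] := dense_near (g s2) dD m2.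
  have := incr _ Dx; rewrite distrC ler_norml => /andP[_].
  have := metric_triangle (g s1) x (g s2).
  rewrite /dist_from (metric_sym (g s2)); lra.
apply: (le_trans step).
have -> : `|s1 - s2| = s2 - s1 by rewrite distrC ger0_norm// subr_ge0.
have ss : s2 - s1 <= d * 2.
  by move: sd1 sd2; rewrite !ler_norml; lra.
have := ler_wpM2l (ltW e10) ss.
have -> : e = e1 * (4 * (1 + K)) by rewrite /e1; field; lra.
by rewrite mulrDl; lra.
Unshelve. all: by end_near. Qed.

Lemma metric_derivative_near e : 0 < e -> \forall d \near 0^'+, forall s1 s2,
  C s1 -> C s2 -> `|s1 - t| <= d -> `|s2 - t| <= d ->
  `|mdist (g s1) (g s2) - c * `|s1 - s2| | <= e * d.
Proof.
move=> e0; apply: filterS2 (fragment_dist_ge e0) (fragment_dist_le e0).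
move=> d ge_d le_d s1 s2 Cs1 Cs2 sd1 sd2; rewrite ler_distl.
by rewrite ge_d// le_d.
Qed.

Lemma dist_speed_metric_derivative : has_metric_derivative C g t c.
Proof.
move=> r r0; apply/fine_cvgP.
pose S (l : R) :=
  [set `|l * mdist (g (t + l^-1 * s.1)) (g (t + l^-1 * s.2))
         - c * `|s.1 - s.2| |%:E
   | s in [set s : R * R | [/\ - r <= s.1 <= r, - r <= s.2 <= r,
       C (t + l^-1 * s.1) & C (t + l^-1 * s.2)]]].
(* As [t] lies in [C], the pair (0, 0) is always admissible, so the supremum is never over an empty
   set. *)
have S0 l : (0 <= ereal_sup (S l))%E.
  apply: ereal_sup_ubound; exists (0, 0) => /=.
    by split; rewrite ?mulr0 ?addr0 ?oppr_le0 ?(ltW r0).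
  by rewrite !mulr0 addr0 subrr mdistxx normr0 !mulr0 subrr normr0.
have Se e : 0 < e -> \forall l \near +oo, (ereal_sup (S l) <= e%:E)%E.
  (* At the scale [r / l] the error [e / r * (r / l)] becomes [e] after multiplication by [l]. *)
  move=> e0; have er : 0 < e / r by rewrite divr_gt0.
  have [m /= m0 mder] := metric_derivative_near er.
  near=> l; have l0 : 0 < l by near: l; exact: nbhs_pinfty_gt.
  have rl0 : 0 < r / l by rewrite divr_gt0.
  have rlm : r / l < m.
    by rewrite ltr_pdivrMr// -ltr_pdivrMl//; near: l;
      apply: nbhs_pinfty_gt; exact: num_real.
  apply: ge_ereal_sup => _ [[u v] /= [ur vr Cu Cv] <-]; rewrite lee_fin.
  have sd w : - r <= w <= r -> `|t + l^-1 * w - t| <= r / l.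
    move=> wr; rewrite addrAC subrr add0r normrM gtr0_norm ?invr_gt0// mulrC.
    by rewrite ler_wpM2r ?invr_ge0 ?(ltW l0)// ler_norml.
  have := mder (r / l) _ rl0 _ _ Cu Cv (sd _ ur) (sd _ vr).
  rewrite /ball_/= sub0r normrN gtr0_norm// => /(_ rlm).
  have -> : t + l^-1 * u - (t + l^-1 * v) = l^-1 * (u - v) by ring.
  rewrite normrM gtr0_norm ?invr_gt0//.
  have -> : e / r * (r / l) = l^-1 * e by field; rewrite !gt_eqF.
  rewrite -[X in `|X|](mulKf (lt0r_neq0 l0)) normrM gtr0_norm ?invr_gt0//.
  rewrite ler_pM2l ?invr_gt0// mulrBr mulrCA.
  by rewrite (mulrA l) divff ?mul1r// gt_eqF.
have Sfin l e : (ereal_sup (S l) <= e%:E)%E -> ereal_sup (S l) \is a fin_num.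
  by move=> Sl; rewrite ge0_fin_numE// (le_lt_trans Sl) ?ltry.
split; first by apply: filterS (Se 1 ltr01) => l; exact: Sfin.
apply/cvgrPdist_le => e e0; apply: filterS (Se e e0) => l Sl.
change (`|0 - fine (ereal_sup (S l))| <= e).
rewrite sub0r normrN ger0_norm ?fine_ge0// -lee_fin fineK//.
exact: Sfin Sl.
Unshelve. all: by end_near. Qed.

End MetricDifferentiability.

(** * Length and multiplicity *)

Section Counting.
Context {T : choiceType} {R : realType}.
Local Open Scope ereal_scope.

Lemma counting_ge (A : set T) (s : seq T) : uniq s ->
  (forall x, x \in s -> A x) -> (size s)%:R%:E <= counting A :> \bar R.
Proof.
move=> us sA; rewrite /counting; case: ifPn => [/asboolP finA|_]; last exact: leey.
rewrite lee_fin ler_nat; apply: uniq_leq_size => // x /sA Ax.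
by rewrite in_fset_set// inE.
Qed.

(** Duplicate-free lists also settle the infinite case: lists of every length force [b = +oo]. *)
Lemma counting_le (A : set T) (b : \bar R) :
  (forall s : seq T, uniq s -> (forall x, x \in s -> A x) -> (size s)%:R%:E <= b) ->
  counting A <= b.
Proof.
move=> sb; rewrite /counting; case: ifPn => [/asboolP finA|/asboolPn infA].
  by apply: sb => [|x]; [exact: fset_uniq|rewrite in_fset_set// inE].
have nb n : n%:R%:E <= b.
  have [B BA nB] := infinite_set_fset n infA.
  rewrite (le_trans _ (sb (enum_fset B) (fset_uniq B) _))//.
  by rewrite lee_fin ler_nat.
case: b nb {sb} => [r| |] nb; first last.
- by have := nb 0%N.
- exact: leey.
by have := nb (Num.truncn r).+1; rewrite lee_fin leNgt truncnS_gt.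
Qed.

End Counting.

Section IntegralWithoutMeasurability.
Context d (T : measurableType d) (R : realType).
Variable mu : {measure set T -> \bar R}.
Local Open Scope ereal_scope.

(* Applied to the multiplicity of a fragment, whose measurability is thus never
   needed. *)
Lemma ge0_le_integralT (f1 f2 : T -> \bar R) : (forall x, 0 <= f1 x) ->
  (forall x, f1 x <= f2 x) -> \int[mu]_x f1 x <= \int[mu]_x f2 x.
Proof.
move=> f10 f12; have f20 x : 0 <= f2 x by exact: le_trans (f10 x) (f12 x).
rewrite !ge0_integralTE//; apply: ge_ereal_sup => _ [h hf <-].
by apply: ereal_sup_ubound; exists h => // x; exact: le_trans (hf x) (f12 x).
Qed.

End IntegralWithoutMeasurability.

Lemma limn_einf_ge {R : realType} (u : (\bar R)^nat) (a : \bar R) :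
  (\forall k \near \oo, a <= u k)%E -> (a <= limn_einf u)%E.
Proof.
move=> [N _ Nu]; rewrite limn_einf_lim (cvg_lim _ (@cvg_einfs_sup _ u))//.
apply: (@le_trans _ _ (einfs u N)); last by apply: ereal_sup_ubound; exists N.
by apply: le_ereal_inf_tmp => _ [k /= Nk <-]; exact: Nu.
Qed.

Lemma limn_einf_le {R : realType} (u : (\bar R)^nat) (a : \bar R) :
  (forall k, u k <= a)%E -> (limn_einf u <= a)%E.
Proof.
move=> ua; rewrite limn_einf_lim (cvg_lim _ (@cvg_einfs_sup _ u))//.
apply: ge_ereal_sup => _ [k _ <-]; apply: le_trans (ua k).
by apply: ereal_inf_lbound; exists k => /=.
Qed.

Section Cells.
Context {R : realType}.

(* The grid of step 1/(k+1) on [-(k+1), k+1[; it has 2(k+1)^2 cells. *)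
Definition grid (k i : nat) : R := - k.+1%:R + i%:R / k.+1%:R.

Definition grid_size k := (k.+1 * k.+1).*2.

Definition grid_index (k : nat) (u : R) := Num.truncn ((u + k.+1%:R) * k.+1%:R).

Lemma grid_indexP k u : - k.+1%:R <= u ->
  grid k (grid_index k u) <= u < grid k (grid_index k u).+1.
Proof.
move=> ku; rewrite /grid !(addrC (- _)) lerBlDr ltrBrDr.
rewrite ler_pdivrMr// ltr_pdivlMr// truncn_itv// mulr_ge0//.
by rewrite -lerBlDr sub0r.
Qed.

Lemma grid_index_size k u : `|u| < k.+1%:R -> (grid_index k u < grid_size k)%N.
Proof.
rewrite ltr_norml => /andP[ku uk]; rewrite truncn_lt_nat; last first.
  by rewrite mulr_ge0// -lerBlDr sub0r ltW.
rewrite /grid_size -muln2 natrM natrM -mulrA (mulrC k.+1%:R 2) mulrA.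
by rewrite ltr_pM2r//; lra.
Qed.

Lemma grid_index_eq k u v : - k.+1%:R <= u -> - k.+1%:R <= v ->
  grid_index k u = grid_index k v -> `|u - v| < k.+1%:R^-1.
Proof.
move=> /grid_indexP + /grid_indexP + uv; rewrite -uv /grid.
rewrite -(@natr1 _ (grid_index k u)) mulrDl mul1r ltr_norml.
by move: k.+1%:R^-1 => w; lra.
Qed.

Lemma grid_trivIset k : trivIset setT (fun i => `[grid k i, grid k i.+1[%classic).
Proof.
apply: ltn_trivIset => n m mn; rewrite -subset0 => u [/=].
rewrite !in_itv/= => /andP[_ um] /andP[nu _].
have : grid k m.+1 <= grid k n.
  by rewrite /grid lerD2l ler_pM2r ?invr_gt0// ler_nat.
by move/(le_trans)/(_ nu); rewrite leNgt um.
Qed.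

End Cells.

(** * Length compared with images of cells and of compact pieces *)

Section Area.
Context {R : realType} {X : completeMetricType R}.
Variables (C : set R) (g : R -> X).
Hypotheses (cC : closed C) (lipg : @metric_lipschitz R R^o X C g).
Local Notation leb := (@lebesgue_measure R).
Local Notation H := (@hausdorff1 R X).
Local Open Scope ereal_scope.

Lemma fragment_image_compact K : compact K -> K `<=` C ->
  measurable (g @` K : set (borel X)).
Proof.
have [L L0 gL] := fragment_lipschitz lipg.
move=> cK KC; have ck : compact (g @` K).
  apply: continuous_compact => //; apply/subspace_continuousP => t Kt.
  apply/cvg_ballP => e e0; rewrite near_withinE.
  have eL : (0 < e / L)%R by rewrite divr_gt0.
  apply: filterS (near_dist_lt t eL) => s st Ks.
  rewrite ballEmdist/= metric_sym (le_lt_trans (gL _ _ (KC _ Ks) (KC _ Kt)))//.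
  by rewrite mulrC -ltr_pdivlMr.
rewrite -(setCK (g @` K)); apply: measurableC; apply: sub_sigma_algebra.
by apply: closed_openC; apply: compact_closed => //; exact: metric_hausdorff.
Qed.

(** A half-open cell of [C] is a countable union of compact sets, whose images are compact. *)
Lemma fragment_image_itv a b :
  measurable (g @` (C `&` `[a, b[) : set (borel X)).
Proof.
pose J n := `[a, (b - n.+1%:R^-1)%R]%classic `&` C.
rewrite (_ : g @` _ = \bigcup_n (g @` J n)).
  apply: bigcupT_measurable => n; apply: fragment_image_compact.
    by apply: compact_closedI => //; exact: segment_compact.
  by move=> t [].
rewrite -image_bigcup; congr image; apply/seteqP; split => t.
  move=> [Ct] /=; rewrite in_itv/= => /andP[at_ tb].
  exists (Num.truncn (b - t)^-1) => //; split => //=; rewrite in_itv/= at_/=.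
  rewrite lerBrDl -lerBrDr ltW// invf_plt ?posrE ?subr_gt0//.
  exact: truncnS_gt.
move=> [n _ [/=]]; rewrite !in_itv/= => /andP[at_ tb] Ct; split => //.
by rewrite at_ (le_lt_trans tb)// ltrBlDr ltrDl invr_gt0.
Qed.

(** A Borel lower approximation of the multiplicity: each cell counts once, however many preimages
    of [x] it holds. *)
Let cells k x := \sum_(i < grid_size k)
  (\1_(g @` (C `&` `[grid k i, grid k i.+1[)) x)%:E : \bar R.

(** A wide and fine enough grid contains the finitely many points of [s] and puts them in distinct
    cells. *)
Let size_le_cells x (s : seq R) : uniq s ->
  (forall t, t \in s -> C t /\ g t = x) ->
  \forall k \near \oo, (size s)%:R%:E <= cells k x.
Proof.
move=> us sx.
pose sep (ij : 'I_(size s) * 'I_(size s)) k :=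
  (`|nth 0%R s ij.1| < k.+1%:R)%R /\
  (ij.1 != ij.2 -> k.+1%:R^-1 < `|nth 0%R s ij.1 - nth 0%R s ij.2|)%R.
have near_sep : \forall k \near \oo, forall ij, sep ij k.
  apply: filter_forall => -[i j]; rewrite /sep/=.
  have [->|ij] := eqVneq i j.
    exists (Num.truncn `|nth 0%R s j|) => // k /= jk; split => //.
    by rewrite (lt_le_trans (truncnS_gt _))// ler_nat ltnS.
  have d0 : (0 < `|nth 0%R s i - nth 0%R s j|)%R.
    rewrite normr_gt0 subr_eq0; apply: contra ij => /eqP/uniqP sij.
    by apply/eqP/val_inj; apply: sij; rewrite // inE.
  near=> k; split; last by move=> _; near: k; exact: near_infty_natSinv_lt (PosNum d0).
  rewrite (lt_le_trans (truncnS_gt _))// ler_nat ltnS.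
  by near: k; exact: nbhs_infty_ge.
apply: filterS near_sep => k sepk.
have sk (i : 'I_(size s)) : (`|nth 0%R s i| < k.+1%:R)%R by have [] := sepk (i, i).
pose f (i : 'I_(size s)) := Ordinal (grid_index_size (sk i)).
have nk (i : 'I_(size s)) : (- k.+1%:R <= nth 0%R s i)%R.
  by have := sk i; rewrite ltr_norml => /andP[/ltW].
have finj : injective f.
  move=> i j /(congr1 val)/= fij; apply/eqP/negPn/negP => ij.
  have := (sepk (i, j)).2 ij; rewrite ltNge => /negP; apply.
  by apply/ltW/grid_index_eq.
rewrite /cells (bigID (mem (f @: [set: 'I_(size s)]%SET)))/=.
apply: (@le_trans _ _ (\sum_(i in f @: [set: 'I_(size s)]%SET)
    (\1_(g @` (C `&` `[grid k i, grid k i.+1[)) x)%:E)); last first.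
  by rewrite leeDl// sume_ge0// => i _; rewrite lee_fin.
rewrite big_imset/=; last by move=> i j _ _; exact: finj.
rewrite (eq_bigr (fun=> 1)); last first.
  move=> i _; rewrite indicE mem_set//.
  have [Ci gi] := sx _ (mem_nth 0%R (ltn_ord i)).
  by exists (nth 0%R s i) => //; split => //=; rewrite in_itv/= grid_indexP.
by rewrite sumEFin lee_fin sumr_const cardsT card_ord.
Unshelve. all: by end_near. Qed.

Lemma multiplicity_le_cells x :
  counting (C `&` g @^-1` [set x]) <= limn_einf (cells ^~ x).
Proof.
apply: counting_le => s us sx; apply: limn_einf_ge.
by apply: size_le_cells => // t /sx[].
Qed.

(** Fatou's lemma takes the liminf out of the integral, and a cell count integrates to the sum of
    the measures of the images. *)
Lemma frag_length_le_cells (b : \bar R) :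
  (forall k, \sum_(i < grid_size k) H (g @` (C `&` `[grid k i, grid k i.+1[)) <= b) ->
  frag_length C g <= b.
Proof.
move=> cellb.
have mcell k i : measurable_fun [set: borel X]
    (fun x => (\1_(g @` (C `&` `[grid k i, grid k i.+1[)) x)%:E : \bar R).
  by apply/measurable_EFinP; apply: measurable_indic; exact: fragment_image_itv.
apply: (@le_trans _ _ (\int[H : {measure set (borel X) -> \bar R}]_x
    limn_einf (cells ^~ x))).
  apply: ge0_le_integralT; last exact: multiplicity_le_cells.
  by move=> x; exact: (counting_ge (s := [::])).
apply: le_trans (fatou _ _ _ _) _ => //.
- by move=> k; exact: emeasurable_sum.
- by move=> k x _; apply: sume_ge0 => i _; rewrite lee_fin.
apply: limn_einf_le => k; apply: le_trans (cellb k).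
rewrite ge0_integral_sum//.
apply: lee_sum => i _; rewrite integral_indic//; last exact: fragment_image_itv.
by rewrite setIT.
Qed.

(** Each [K j] whose image contains [x] supplies a preimage of [x], and disjointness makes these
    preimages distinct. *)
Lemma sum_hausdorff1_le_frag_length n (K : nat -> set R) :
  (forall j, compact (K j)) -> (forall j, K j `<=` C) -> trivIset setT K ->
  \sum_(j < n) H (g @` K j) <= frag_length C g.
Proof.
move=> cK KC tK.
have mK j : measurable (g @` K j : set (borel X)) by exact: fragment_image_compact.
have -> : \sum_(j < n) H (g @` K j) =
    \int[H : {measure set (borel X) -> \bar R}]_x
      \sum_(j < n) (\1_(g @` K j) x)%:E.
  rewrite ge0_integral_sum//; last first.
    by move=> j; apply/measurable_EFinP; exact: measurable_indic.
  by apply: eq_bigr => j _; rewrite integral_indic// setIT.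
apply: ge0_le_integralT => x; first by apply: sume_ge0 => j _; rewrite lee_fin.
pose s := [seq j : 'I_n <- enum 'I_n | x \in g @` K j].
have preim (j : 'I_n) : exists t, x \in g @` K j -> K j t /\ g t = x.
  have [/set_mem[t Kt gt]|_] := boolP (x \in g @` K j); first by exists t.
  (* An arbitrary value: [s] retains only the indices [j] with [x] in the image of [K j]. *)
  by exists 0%R.
have [p pK] := choice preim.
have -> : \sum_(j < n) (\1_(g @` K j) x)%:E = (size (map p s))%:R%:E :> \bar R.
  rewrite size_map size_filter -sum1_count natr_sum sumEFin big_enum_cond/=.
  by rewrite [in RHS]big_mkcond/=; congr (_%:E); apply: eq_bigr => j _;
    rewrite indicE; case: (x \in _).
apply: counting_ge.
  rewrite map_inj_in_uniq; first exact/filter_uniq/enum_uniq.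
  move=> i j.
  rewrite !mem_filter => /andP[/pK[Ki _] _] /andP[/pK[Kj _] _] pij.
  apply: val_inj; apply: (tK i j) => //.
  by exists (p i); split => //; rewrite pij.
move=> t /mapP[j]; rewrite mem_filter => /andP[/pK[Kj gj] _] ->.
by split => //; exact: (KC j).
Qed.

End Area.

(** * The area formula *)

Lemma countable_enumeration (T : countType) :
  exists f : nat -> option T, forall x, exists k, f k = Some x.
Proof.
exists (@choice.unpickle T) => x; exists (choice.pickle x).
exact: choice.pickleK.
Qed.

Section AreaFormula.
Context {R : realType} {X : completeMetricType R}.
Variables (C Z : set R) (g : R -> X) (m : R -> R).
Hypotheses (cC : closed C) (lipg : @metric_lipschitz R R^o X C g).
Local Notation leb := (@lebesgue_measure R).
Local Notation H := (@hausdorff1 R X).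
Hypotheses (mZ : measurable Z) (Z0 : leb Z = 0%E).
(** The null set [Z] absorbs the exceptional points; on [P] the fragment has speed [m], unique
    because the points of [P] are limit points of [C]. *)
Local Notation P := (C `\` Z).
Hypothesis limP : forall t, P t -> limit_point C t.
Hypothesis m0 : forall t, P t -> 0 <= m t.
Hypothesis speed : forall t, P t -> forall e, 0 < e ->
  \forall s \near t, C s -> `|mdist (g s) (g t) - m t * `|s - t| | <= e * `|s - t|.

Let mP : measurable P.
Proof. by apply: measurableD => //; exact: closed_measurable. Qed.

Lemma speed_slope t e : P t -> 0 < e -> exists n, forall s, C s ->
  `|s - t| < n.+1%:R^-1 -> `|mdist (g s) (g t) - m t * `|s - t| | <= e * `|s - t|.
Proof.
move=> Pt e0; have [d /= d0 dm] := speed Pt e0.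
exists (Num.truncn d^-1) => s Cs sd; apply: dm => //=.
by rewrite distrC (lt_trans sd)// invf_plt ?posrE// truncnS_gt.
Qed.

Lemma slope_le_speed t c : P t -> m t < c -> exists n, slope_le C g c n t.
Proof.
move=> Pt mc; have e0 : 0 < c - m t by rewrite subr_gt0.
have [n nm] := speed_slope Pt e0; exists n; split => [|s Cs sn].
  by case: Pt.
by have := nm _ Cs sn; rewrite ler_norml mulrBl => /andP[_]; lra.
Qed.

Lemma slope_ge_speed t c : P t -> c < m t -> exists n, slope_ge C g c n t.
Proof.
move=> Pt mc; have e0 : 0 < m t - c by rewrite subr_gt0.
have [n nm] := speed_slope Pt e0; exists n; split => [|s Cs sn].
  by case: Pt.
by have := nm _ Cs sn; rewrite ler_norml mulrBl => /andP[+ _]; lra.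
Qed.

Lemma speed_le_slope t c n : P t -> slope_le C g c n t -> m t <= c.
Proof.
move=> Pt [Ct ct]; apply/ler_addgt0Pr => e e0.
have n0 : 0 < n.+1%:R^-1 :> R by rewrite invr_gt0.
have [s [st Cs [sm sn]]] := limP Pt (filterI (speed Pt e0) (near_dist_lt t n0)).
have st0 : 0 < `|s - t| by rewrite normr_gt0 subr_eq0.
rewrite -(ler_pM2r st0) mulrDl; have := ct _ Cs sn; have := sm Cs.
by rewrite ler_norml => /andP[]; lra.
Qed.

(** By [slope_le_speed] and [speed_le_slope], the set where [m < y] is the union, over rationals
    [q < y] and all scales, of closed sets [slope_le]. *)
Lemma measurable_speed : measurable_fun P m.
Proof.
move=> _; apply: (measurability _ (RGenInftyO.measurableE R)) => //.
move=> _ [_ [y ->] <-]; have [rat_of enum_rat] := countable_enumeration rat.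
have -> : P `&` m @^-1` `]-oo, y[ = P `&` \bigcup_k \bigcup_n
    (if rat_of k is Some q then
       if ratr q < y then slope_le C g (ratr q) n else set0 else set0).
  apply/seteqP; split => t [Pt] /=; rewrite ?in_itv/=.
    move=> my; split => //; have [q] := rat_in_itvoo my.
    rewrite in_itv/= => /andP[mq qy].
    have [n tn] := slope_le_speed Pt mq.
    have [k kq] := enum_rat q.
    by exists k => //; exists n => //; rewrite kq qy.
  move=> [k _ [n _]]; case: (rat_of k) => // q; case: ifP => // qy tn; split => //.
  by rewrite (le_lt_trans (speed_le_slope Pt tn)).
apply: measurableI => //; apply: bigcupT_measurable => k.
apply: bigcupT_measurable => n; case: (rat_of k) => // q; case: ifP => // _.
by apply: closed_measurable; exact: closed_slope_le.
Qed.

Let measurable_speedE E : measurable E -> E `<=` P ->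
  measurable_fun E (fun t => (m t)%:E).
Proof.
by move=> mE EP; apply/measurable_EFinP; exact: measurable_funS measurable_speed.
Qed.

Lemma hausdorff1_image_le E : measurable E -> E `<=` C -> (leb E < +oo)%E ->
  (H (g @` E) <= \int[leb]_(t in E `\` Z) (m t)%:E)%E.
Proof.
move=> mE EC Efin; have [L L0 gL] := fragment_lipschitz lipg.
apply/lee_addgt0Pr => e e0.
(* The excess [d * leb E] is then at most [e]; the 1 keeps the denominator positive. *)
pose d := e / (1 + fine (leb E)).
have fE0 : 0 <= fine (leb E) by rewrite fine_ge0.
have d0 : 0 < d by rewrite divr_gt0// ltr_wpDr.
pose F i := (E `\` Z) `&` m @^-1` `[i%:R * d, i.+1%:R * d[.
have mEZ : measurable (E `\` Z) by exact: measurableD.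
have EZP : E `\` Z `<=` P by move=> t [/EC].
have mF i : measurable (F i).
  exact: (measurable_funS mP EZP measurable_speed) => //.
have FE : E `\` Z = \bigcup_i F i.
  apply/seteqP; split => t; last by move=> [i _ []].
  move=> Et; exists (Num.truncn (m t / d)) => //; split => //=.
  rewrite in_itv/= -ler_pdivlMr// -ltr_pdivrMr// truncn_itv// divr_ge0 ?(ltW d0)//.
  exact: m0 (EZP _ Et).
have tF : trivIset setT F.
  apply: ltn_trivIset => j i ij; rewrite -subset0 => t [[_ /=] + [_ /=]].
  rewrite !in_itv/= => /andP[_ mi] /andP[mj _].
  have : i.+1%:R * d <= j%:R * d by rewrite ler_pM2r// ler_nat.
  by move/(le_trans)/(_ mj); rewrite leNgt mi.
have mmd A : measurable A -> A `<=` P -> measurable_fun A (fun t => (m t + d)%:E).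
  move=> mA AP; apply/measurable_EFinP; apply: measurable_funD => //.
  exact: measurable_funS measurable_speed.
have FP i : F i `<=` P by move=> t [/EZP].
have HF i : (H (g @` F i) <= \int[leb]_(t in F i) (m t + d)%:E)%E.
  apply: (@le_trans _ _ ((i.+1%:R * d)%:E * leb (F i))%E).
    apply: (hausdorff1_slope_le cC lipg) => //; first by rewrite mulr_ge0// ltW.
    move=> t Ft; have [n tn] : exists n, slope_le C g (i.+1%:R * d) n t.
      apply: slope_le_speed; first exact: FP Ft.
      by case: Ft => _ /=; rewrite in_itv/= => /andP[].
    by exists n.
  (* On the slice [m] is at least i d, so the constant (i+1) d is at most m + d. *)
  have <- := integral_cst leb (mF i) (i.+1%:R * d)%:E.
  apply: ge0_le_integral => //.
  - exact: mF.
  - by move=> t _; rewrite lee_fin mulr_ge0// ltW.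
  - exact: mmd.
  - move=> t [_ /=]; rewrite in_itv/= => /andP[it _].
    by rewrite lee_fin -natr1 mulrDl mul1r lerD2r.
have EZ : E `<=` (E `&` Z) `|` (E `\` Z).
  by move=> t Et; have [Zt|nZt] := pselect (Z t); [left|right].
apply: (@le_trans _ _ (H (g @` (E `&` Z)) + H (g @` (E `\` Z)))%E).
  apply: le_trans (outer_measureU2 H _ _); apply: le_outer_measure.
  by rewrite -image_setU; exact: image_subset.
(* A Lipschitz image of a null set is null. *)
have -> : H (g @` (E `&` Z)) = 0%E.
  apply/eqP; rewrite eq_le outer_measure_ge0 andbT.
  have /le_trans : (H (g @` (E `&` Z)) <= L%:E * leb (E `&` Z))%E.
    apply: (@hausdorff1_lipschitz _ _ _ _ _ 1) => //; first exact: ltW.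
    by move=> s t [/EC Cs _] [/EC Ct _] _; exact: gL.
  apply; have -> : leb (E `&` Z) = 0%E.
    apply/eqP; rewrite eq_le lebesgue_ge0 andbT -Z0.
    by apply: le_lebesgue => t [].
  by rewrite mule0.
rewrite add0e; apply: (@le_trans _ _ (\int[leb]_(t in E `\` Z) (m t + d)%:E)%E).
  rewrite [in leRHS]FE ge0_integral_bigcup//; last 2 first.
  - by rewrite -FE; exact: mmd.
  - move=> t; rewrite -FE => /EZP Pt; rewrite lee_fin addr_ge0 ?m0//.
    exact: ltW.
  rewrite FE image_bigcup.
  apply: le_trans (outer_measure_sigma_subadditive H _) _.
  by apply: lee_nneseries => [i _ _|i _]; [exact: outer_measure_ge0|exact: HF].
under eq_integral do rewrite EFinD.
rewrite ge0_integralD//; last 3 first.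
- by move=> t /EZP /m0; rewrite lee_fin.
- exact: measurable_speedE.
- by move=> t _; rewrite lee_fin ltW.
rewrite leeD2l// integral_cst// (@le_trans _ _ (d%:E * leb E)%E)//.
  by rewrite lee_wpmul2l ?lee_fin ?(ltW d0)// le_lebesgue//; exact: subDsetl.
rewrite -(@fineK _ (leb E)) ?ge0_fin_numE ?lebesgue_ge0// -EFinM lee_fin /d.
by rewrite mulrAC ler_pdivrMr ?ltr_wpDr// ler_pM2l// lerDr.
Qed.

(** Each cell has finite measure, so the slicing estimate applies to it; the cells are disjoint and
    their integrals add up to at most the integral over [P]. *)
Lemma frag_length_le_integral : (frag_length C g <= \int[leb]_(t in P) (m t)%:E)%E.
Proof.
apply: frag_length_le_cells => // k.
pose J i := C `&` `[grid k i, grid k i.+1[%classic.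
have mC : measurable C by exact: closed_measurable.
have mJ i : measurable (J i) by exact: measurableI.
have mJZ i : measurable (J i `\` Z) by exact: measurableD.
have JP i : J i `\` Z `<=` P by move=> t [[]].
have tJ : trivIset setT (fun i => J i `\` Z).
  move=> i j _ _ [t [[[_ ti] _] [[_ tj] _]]].
  by apply: (grid_trivIset (k := k) (i := i) (j := j)) => //; exists t.
apply: (@le_trans _ _ (\sum_(i < grid_size k) \int[leb]_(t in J i `\` Z) (m t)%:E)%E).
  apply: lee_sum => i _; apply: hausdorff1_image_le; first exact: mJ.
    by move=> t [].
  apply: le_lt_trans (le_lebesgue (@subIsetr _ _ _)) _.
  by rewrite lebesgue_measure_itv/=; case: ifP; rewrite -?EFinD ltry.
apply: (@le_trans _ _ (\int[leb]_(t in \bigcup_i (J i `\` Z)) (m t)%:E)%E).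
  have UP : \bigcup_i (J i `\` Z) `<=` P by move=> t [i _ /JP].
  have mU : measurable (\bigcup_i (J i `\` Z)).
    exact: bigcupT_measurable.
  rewrite ge0_integral_bigcup//; last 2 first.
  - exact: measurable_speedE.
  - by move=> t /UP /m0; rewrite lee_fin.
  rewrite -(big_mkord xpredT (fun i => \int[leb]_(t in J i `\` Z) (m t)%:E)%E).
  by apply: nneseries_lim_ge => i _ _; apply: integral_ge0 => t /JP /m0; rewrite lee_fin.
apply: ge0_subset_integral => //.
- exact: bigcupT_measurable.
- exact: measurable_speedE.
- by move=> t [i _ /JP].
Qed.

(** Inner regularity replaces each [B j] by a compact subset, and expansion bounds the measure of
    its image from below. *)
Lemma sum_expanding_le_frag_length n (B : nat -> set R) (q : nat -> R) :
    (forall j, measurable (B j)) -> (forall j, B j `<=` C) -> trivIset setT B ->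
    (forall j, (leb (B j) < +oo)%E) -> (forall j, 0 < q j) ->
    (forall j s t, B j s -> B j t -> q j * `|s - t| <= mdist (g s) (g t)) ->
  (\sum_(j < n) (q j)%:E * leb (B j) <= frag_length C g)%E.
Proof.
move=> mB BC tB finB q0 qB; apply/lee_addgt0Pr => e e0.
have sq0 : 0 <= \sum_(j < n) q j by apply: sumr_ge0 => j _; exact: ltW.
(* At most [d] of the measure of each [B j] is lost, at a total cost of [d] times the sum of the
   [q j]. *)
pose d := e / (1 + \sum_(j < n) q j).
have d0 : 0 < d by rewrite divr_gt0// ltr_wpDr.
have [K KB] := choice (fun j => lebesgue_regularity_inner (mB j) (finB j) d0).
have KBj j : K j `<=` B j by have [] := KB j.
have tK : trivIset setT K.
  move=> i j _ _ [t [Ki Kj]]; apply: (tB i j) => //.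
  by exists t; split; exact: KBj.
have cK j : compact (K j) by have [] := KB j.
have KC j : K j `<=` C by exact: subset_trans (KBj j) (BC j).
apply: (@le_trans _ _ (\sum_(j < n) H (g @` K j) + e%:E)%E); last first.
  by rewrite leeD2r//; exact: sum_hausdorff1_le_frag_length.
apply: (@le_trans _ _ (\sum_(j < n) (H (g @` K j) + (q j * d)%:E))%E); last first.
  rewrite big_split/= leeD2l// sumEFin lee_fin -mulr_suml /d mulrCA.
  rewrite ger_pMr// ler_pdivrMr ?ltr_wpDr// mul1r lerDr//.
apply: lee_sum => j _; have [_ _ BK] := KB j.
apply: (@le_trans _ _ ((q j)%:E * (leb (K j) + leb (B j `\` K j)))%E).
  rewrite lee_wpmul2l ?lee_fin ?(ltW (q0 j))//.
  by rewrite -{1}(setDUK (KBj j)); exact: lebesgueU2.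
rewrite ge0_muleDr ?lebesgue_ge0//; apply: leeD.
  by apply: hausdorff1_expanding => // s t /KBj Bs /KBj Bt; exact: qB Bs Bt.
by rewrite EFinM lee_wpmul2l ?lee_fin ?(ltW (q0 j))// ltW.
Qed.

(* B consists of pieces on which r m <= q and which are short enough for g to be
   q-expanding on the whole piece. *)
Lemma integral_le_frag_length : (\int[leb]_(t in P) (m t)%:E <= frag_length C g)%E.
Proof.
(* Working with a factor [r < 1] leaves room for a rational rate between [r * m t] and [m t]. *)
apply/lee_mul01Pr; first by apply: integral_ge0 => t /m0; rewrite lee_fin.
move=> r /andP[r0 r1].
(* A code (a, n, b) stands for the expansion rate a, the scale 1/(n+1) and the centre b; the value 1
   elsewhere keeps every [q j] positive. *)
have [code enum_code] := countable_enumeration (rat * nat * rat)%type.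
pose q j : R := if code j is Some (a, n, b) then
  if 0 < ratr a :> R then ratr a else 1 else 1.
have q0 j : 0 < q j by rewrite /q; case: (code _) => [[[a n] b]|//]; case: ifP.
(* The radius is half the scale, so any two points of a piece are closer than the scale. *)
pose F j : set R := if code j is Some (a, n, b) then
  (P `&` m @^-1` `]-oo, q j / r]) `&` slope_ge C g (q j) n `&`
  ball (ratr b : R) (n.+1%:R^-1 / 2) else set0.
pose B := seqDU F.
have mPm y : measurable (P `&` m @^-1` `]-oo, y]) by exact: measurable_speed.
have mF j : measurable (F j).
  rewrite /F; case: (code _) => [[[a n] b]|//]; apply: measurableI.
    by apply: measurableI => //; apply: closed_measurable; exact: closed_slope_ge.
  exact: measurable_ball.
have mB j : measurable (B j) by exact: seqDU_measurable.
have BF j : B j `<=` F j by move=> t [].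
have FP j : F j `<=` P by rewrite /F; case: (code _) => [[[a n] b]|//] t [[[]]].
have BP j : B j `<=` P by exact: subset_trans (BF j) (FP j).
have finB j : (leb (B j) < +oo)%E.
  apply: le_lt_trans (le_lebesgue (BF j)) _; rewrite /F.
  case: (code _) => [[[a n] b]|]; last by rewrite measure0 ltry.
  apply: le_lt_trans (le_lebesgue (@subIsetr _ _ _)) _.
  by rewrite lebesgue_measure_ball ?ltry// divr_ge0.
have qB j s t : B j s -> B j t -> q j * `|s - t| <= mdist (g s) (g t).
  move=> /BF + /BF; rewrite /F; case: (code _) => [[[a n] b]|//].
  move=> [[_ [Cs _]] bs] [[_ [_ qt]] bt]; apply: qt => //.
  by have := ball_triangle (ball_sym bt) bs; rewrite -splitr /ball/= distrC.
have mq j t : B j t -> r * m t <= q j.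
  move=> /BF; rewrite /F; case: (code _) => [[[a n] b]|//] [[[_ +] _] _].
  by rewrite /= in_itv/= ler_pdivlMr// mulrC.
have cover t : P t -> 0 < m t -> (\bigcup_j B j) t.
  move=> Pt mt; rewrite -seqDU_bigcup_eq.
  have rm : r * m t < m t by rewrite gtr_pMl.
  have [a] := rat_in_itvoo rm; rewrite in_itv/= => /andP[ra am].
  have a0 : 0 < ratr a :> R by rewrite (lt_trans _ ra)// mulr_gt0.
  have [n tn] := slope_ge_speed Pt am.
  have n0 : 0 < n.+1%:R^-1 / 2 :> R by rewrite divr_gt0.
  have [b] : exists b : rat, ratr b \in `](t - n.+1%:R^-1 / 2), t[.
    by apply: rat_in_itvoo; rewrite ltrBlDr ltrDl.
  rewrite in_itv/= => /andP[tb bt].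
  have [j jc] := enum_code (a, n, b).
  exists j => //; rewrite /F /q jc a0.
  split; first split => //.
    by split => //=; rewrite in_itv/= ler_pdivlMr// mulrC ltW.
  by rewrite /ball/= distrC gtr0_norm ?subr_gt0// ltrBlDr -ltrBlDl.
(* Points where [m] vanishes need not be covered; they contribute nothing to the integral. *)
have -> : (\int[leb]_(t in P) (m t)%:E = \int[leb]_(t in \bigcup_j B j) (m t)%:E)%E.
  rewrite integral_mkcond [RHS]integral_mkcond; congr (integral _ _ _).
  apply/funext => t; rewrite /patch; case: ifPn => [/set_mem Pt|nPt].
    case: ifPn => // /negP nBt; have := m0 Pt; rewrite le_eqVlt.
    move=> /predU1P[<-//|mt].
    by exfalso; apply: nBt; apply: mem_set; exact: cover.
  rewrite ifF//; apply/negbTE; apply: contra nPt => /set_mem[j _ /BP Pt].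
  exact: mem_set.
have mU : measurable (\bigcup_j B j) by exact: bigcupT_measurable.
have UP : \bigcup_j B j `<=` P by move=> t [j _ /BP].
rewrite ge0_integral_bigcup//; last 3 first.
- exact: measurable_speedE.
- by move=> t /UP /m0; rewrite lee_fin.
- exact: trivIset_seqDU.
have int0 j : (0 <= \int[leb]_(t in B j) (m t)%:E)%E.
  by apply: integral_ge0 => t /BP /m0; rewrite lee_fin.
rewrite -nneseriesZl//; apply: lime_le.
  by apply: is_cvg_nneseries => j _ _; rewrite mule_ge0// lee_fin ltW.
apply: nearW => n; rewrite big_mkord.
apply: le_trans (@sum_expanding_le_frag_length n B q mB _
  (trivIset_seqDU F) finB q0 qB); last first.
  by move=> j t /BP[].
apply: lee_sum => j _; rewrite -ge0_integralZl//; last 4 first.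
- exact: mB.
- exact: measurable_speedE.
- by move=> t /BP /m0; rewrite lee_fin.
- by rewrite lee_fin ltW.
have <- := integral_cst leb (mB j) (q j)%:E.
apply: ge0_le_integral => //.
- exact: mB.
- by move=> t /BP /m0 mt; rewrite -EFinM lee_fin mulr_ge0// ltW.
- by apply: measurable_funeM; exact: measurable_speedE.
- by move=> t Bt; rewrite -EFinM lee_fin; exact: mq.
Qed.

Theorem area_formula : frag_length C g = (\int[leb]_(t in P) (m t)%:E)%E.
Proof.
by apply/eqP; rewrite eq_le frag_length_le_integral integral_le_frag_length.
Qed.

End AreaFormula.

(** * Generic pairs *)

Section NullSets.
Context d (T : measurableType d) (R : realType).
Variable mu : {measure set T -> \bar R}.
Variable Z : set T.
Hypotheses (mZ : measurable Z) (Z0 : mu Z = 0%E).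
Local Open Scope ereal_scope.

Import HBNNSimple.

(** The integral of a nonnegative function is the supremum of the integrals of the simple functions
    below it, and each of these can be cut off to vanish on [Z] at no cost. *)
Let ge0_integral_setC_null (f : T -> \bar R) : (forall x, 0 <= f x) ->
  \int[mu]_x f x = \int[mu]_(x in ~` Z) f x.
Proof.
move=> f0; apply/eqP; rewrite eq_le; apply/andP; split; last first.
  rewrite integral_mkcond; apply: ge0_le_integralT => x;
    by rewrite /patch; case: ifP.
rewrite [leLHS]ge0_integralTE//; apply: ge_ereal_sup => _ [h hf <-].
have := @integral_nnsfun _ _ _ mu setT measurableT h.
rewrite patch_setT => <-.
rewrite (@ge0_negligible_integral _ _ _ _ setT Z)//; last 2 first.
- by apply/measurable_EFinP; exact: measurable_funPT.
- by move=> x _; rewrite lee_fin.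
rewrite setTD integral_mkcond [leRHS]integral_mkcond.
by apply: ge0_le_integralT => x; rewrite /patch; case: ifP => // _;
  rewrite lee_fin.
Qed.

(* Off Z only, the norm of the velocity will be known to be measurable; the
   library's version of this lemma assumes measurability on D. *)
Lemma integral_setD_null (D : set T) (f : T -> \bar R) :
  \int[mu]_(x in D) f x = \int[mu]_(x in D `\` Z) f x.
Proof.
have part (u : T -> \bar R) : (forall x, 0 <= u x) ->
    \int[mu]_(x in D) u x = \int[mu]_(x in D `\` Z) u x.
  move=> u0; rewrite integral_mkcond ge0_integral_setC_null.
    rewrite integral_mkcond [RHS]integral_mkcond -patch_setI setIC.
    by rewrite setDE.
  by move=> x; rewrite /patch; case: ifP.
by rewrite integralE [RHS]integralE !part.
Qed.

End NullSets.

Section GenericPairs.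
Context {R : realType} {X : completeMetricType R}.

Lemma partialsP n (phi : 'I_n -> X -> R) (f : X -> R) p :
  differentiable_wrt phi f p -> is_differential phi f p (partials phi f p).
Proof.
by move=> [c [fc _]]; apply: (@xgetPex _ 0 [set c | is_differential phi f p c]);
  exists c.
Qed.

Variables (mu : {measure set (borel X) -> \bar R}) (A : chart_family X).
Hypothesis hA : is_atlas mu A.
Variables (D : set X) (F Bf : set (X -> R)) (Y : set (borel X)).
Hypotheses (dD : dense D).
Hypothesis coordF : forall (a : chart A) (i : 'I_(chart_dim a)), F (chart_fun a i).
Hypotheses (Ydom : Y `<=` \bigcup_(a : chart A) chart_dom a)
  (Ynorm : forall p, Y p -> norm_from_distances A D p).
Variables (C : set R) (g : R -> X).
Hypothesis fragg : is_fragment C g.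
Let cC : closed C := fragg.1.
Let lipg : @metric_lipschitz R R^o X C g := fragg.2.

Lemma generic_derivable t : generic F Bf D Y C g t ->
  forall x, D x -> frag_derivable C (dist_from x \o g) t.
Proof. by move=> [_ _ _ [apD _] _] x /apD[]. Qed.

Lemma generic_metric_derivative t : generic F Bf D Y C g t ->
  has_metric_derivative C g t (dist_speed C g D t).
Proof.
move=> gt; have [[Ct _] _ _ [_ [_ apx]] _] := gt.
by apply: dist_speed_metric_derivative => //; exact: generic_derivable.
Qed.

(** The metric derivative estimate with one of the two points at [t] and the scale |s - t|. *)
Lemma generic_speed t e : generic F Bf D Y C g t -> 0 < e ->
  \forall s \near t, C s ->
    `|mdist (g s) (g t) - dist_speed C g D t * `|s - t| | <= e * `|s - t|.
Proof.
move=> gt e0; have [[Ct _] _ _ [_ [_ apx]] _] := gt.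
have [r /= r0 rd] :=
  metric_derivative_near cC lipg dD (generic_derivable gt) apx e0.
apply: filterS (near_dist_lt t r0) => s sr Cs.
have [->|st] := eqVneq s t.
  by rewrite mdistxx subrr normr0 !mulr0 subrr normr0.
have st0 : 0 < `|s - t| by rewrite normr_gt0 subr_eq0.
apply: (rd `|s - t|) => //=; first by rewrite sub0r normrN normr_id.
by rewrite subrr normr0.
Qed.


(** By the chain rule, the velocity transforms correctly between charts, and the differential of a
    distance function evaluates on it to the derivative along the fragment; the formula for the norm
    by distances then yields the speed. *)
Lemma generic_tangent_norm t : generic F Bf D Y C g t ->
  tangent_norm (g t) (@velocity R X A C g t) = (dist_speed C g D t)%:E.
Proof.
move=> gt; have [[Ct _] apF _ _ Yt] := gt.
have derD := generic_derivable gt.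
have lt := speed_limit_point dD derD.
have [a _ pa] := Ydom Yt; have [dif norm] := Ynorm Yt pa.
have coord (b : chart A) i : is_frag_derive C (chart_fun b i \o g) t
    (@velocity R X A C g t b 0 i).
  by rewrite mxE; apply: frag_derivableP; have [] := apF _ (coordF i).
rewrite norm; last first.
  (* Both sides are derivatives of the same chart function along the fragment at a limit point,
     hence equal. *)
  move=> b b' pb pb' i; have [_ _ /(_ b b' _ pb pb' i)/partialsP dphi] := hA.
  apply: (is_frag_derive_unique lt (coord b i)).
  exact: is_frag_derive_chain dphi (coord b').
have -> : [set `|pairing (partials (chart_fun a) (dist_from x) (g t))
    (@velocity R X A C g t a)|%:E | x in D] =
    [set r%:E | r in [set `|frag_derive C (dist_from x \o g) t| | x in D]].
  rewrite -image_comp; congr image.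
  apply: eq_imagel => x Dx /=; congr `|_|.
  apply: (is_frag_derive_unique lt); last exact: frag_derivableP (derD _ Dx).
  exact: is_frag_derive_chain lipg Ct (partialsP (dif _ Dx)) (coord a).
have [ne ub] := speed_has_sup (C := C) (g := g) t lipg dD derD.
by rewrite ereal_sup_EFin.
Qed.

End GenericPairs.

(** * Metric differentiability and length of generic fragments *)

Theorem theorem1p7 (R : realType) (X : completeMetricType R)
  (mu : {measure set (borel X) -> \bar R}) (hmu : radon mu)
  (A : chart_family X) (hA : is_atlas mu A)
  (D : set X) (hDc : countable D) (hDd : dense D)
  (F : set (X -> R)) (hFc : countable F)
  (hFlip : forall f, F f -> real_lipschitz f)
  (hFcoord : forall (a : chart A) (i : 'I_(chart_dim a)), F (chart_fun a i))
  (Y : set (borel X)) (hYm : measurable Y)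
  (hYdom : Y `<=` \bigcup_(a : chart A) chart_dom a) (hYmu : mu (~` Y) = 0%E)
  (hYnorm : forall p, Y p -> norm_from_distances A D p)
  (Bf : set (X -> R)) (hBc : countable Bf)
  (hBbd : forall u, Bf u -> exists M : R, forall x, `|u x| <= M)
  (hBm : forall u, Bf u -> measurable_fun [set: borel X] (u : borel X -> R))
  (hBdom : forall a : chart A, Bf (\1_(chart_dom a)))
  (hBY : Bf (\1_Y))
  (C : set R) (gamma : R -> X) (hgamma : is_fragment C gamma) :
  (forall t, generic F Bf D Y C gamma t ->
     exists c : R, [/\ 0 <= c, has_metric_derivative C gamma t c
       & tangent_norm (gamma t) (@velocity R X A C gamma t) = c%:E]) /\
  ({ae lebesgue_measure, forall t : R, C t -> generic F Bf D Y C gamma t} ->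
     frag_length C gamma =
     (\int[lebesgue_measure]_(t in C)
        tangent_norm (gamma t) (@velocity R X A C gamma t))%E).
Proof.
have norm_speed t : generic F Bf D Y C gamma t ->
    tangent_norm (gamma t) (@velocity R X A C gamma t) =
    (dist_speed C gamma D t)%:E.
  exact: (generic_tangent_norm hA hDd hFcoord hYdom hYnorm hgamma).
have [cC lipg] := hgamma.
split=> [t gt|[Z [mZ Z0 genZ]]].
  exists (dist_speed C gamma D t); split; last exact: norm_speed.
    by apply: dist_speed_ge0 => //; exact: generic_derivable gt.
  exact: generic_metric_derivative gt.
have gen t : (C `\` Z) t -> generic F Bf D Y C gamma t.
  by move=> [Ct nZt]; apply: contrapT => ngen; apply: nZt; apply: genZ => /(_ Ct).
(* On [Z] the norm of the velocity may differ from the speed; once [Z] is removed, the two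
   integrands agree. *)
rewrite (integral_setD_null mZ Z0).
rewrite (@area_formula _ _ C Z gamma (dist_speed C gamma D))//.
- by apply: eq_integral => t /set_mem/gen/norm_speed.
- by move=> t /gen gt; exact: speed_limit_point hDd (generic_derivable gt).
- by move=> t /gen gt; apply: dist_speed_ge0 => //; exact: generic_derivable gt.
- by move=> t /gen gt e e0; exact: generic_speed gt e0.
Qed.
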